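(* Let $\mathcal{H}$ be a separable right quaternionic Hilbert space and let $T\in\mathcal{B}(\mathcal{H})$ be a normal operator. Then there exist an orthonormal basis $\{e_n:n\in\mathbb{N}\}$ of $\mathcal{H}$ and an operator $D\in\mathcal{B}(\mathcal{H})$, diagonal with respect to this basis, such that $T\sim_a D$, where $D(e_n)=e_nd_n$ and $d_n\in\mathbb{C}^+$ for all $n\in\mathbb{N}$.
   Context: $\mathbb{H}$ denotes the real quaternions with basis $\{1,i,j,k\}$, $\mathbb{C}=\mathrm{span}_{\mathbb{R}}\{1,i\}\subset\mathbb{H}$, and $\mathbb{C}^+$ is the closed upper half-plane of $\mathbb{C}$. $\mathcal{H}$ is a right quaternionic Hilbert space with inner product $\langle\cdot,\cdot\rangle$ that is right $\mathbb{H}$-linear in the first variable, satisfies $\langle x,y\rangle=\langle y,x\rangle^*$ and is positive definite; $\mathcal{H}$ is separable, with countable orthonormal bases indexed by $\mathbb{N}$. $\mathcal{B}(\mathcal{H})$ is the set of bounded right $\mathbb{H}$-linear operators on $\mathcal{H}$ with the operator norm; $T$ is normal if $T^*T=TT^*$. $T\sim_a D$ (approximate unitary equivalence) means there is a sequence of unitary operators $(U_n)_n$ on $\mathcal{H}$ with $\lim_{n\to\infty}\|U_nDU_n^*-T\|=0$. *)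

(* Defs.v *)
From HB Require Import structures.
From mathcomp Require Import all_boot all_order all_algebra.
From mathcomp Require Import ring.
From mathcomp Require Import all_classical all_reals all_analysis.

Set Implicit Arguments.
Unset Strict Implicit.
Unset Printing Implicit Defensive.

Import Order.TTheory GRing.Theory Num.Theory.
Import numFieldNormedType.Exports.

Local Open Scope classical_set_scope.
Local Open Scope ring_scope.

(* [Quat a b c d] is a + b i + c j + d k. *)
Record quat (R : realType) := Quat { qre : R; qim : R; qj : R; qk : R }.

Section QuatRing.
Variable R : realType.
Implicit Types p q r : quat R.

Definition quat_to q := (qre q, qim q, qj q, qk q).
Definition quat_of (t : R * R * R * R) : quat R :=
  let: (a, b, c, d) := t in Quat a b c d.

Lemma quat_toK : cancel quat_to quat_of. Proof. by case. Qed.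

HB.instance Definition _ := Choice.copy (quat R) (can_type quat_toK).

Definition qadd p q :=
  Quat (qre p + qre q) (qim p + qim q) (qj p + qj q) (qk p + qk q).
Definition qopp q := Quat (- qre q) (- qim q) (- qj q) (- qk q).
Definition qmul p q :=
  Quat (qre p * qre q - qim p * qim q - qj p * qj q - qk p * qk q)
       (qre p * qim q + qim p * qre q + qj p * qk q - qk p * qj q)
       (qre p * qj q - qim p * qk q + qj p * qre q + qk p * qim q)
       (qre p * qk q + qim p * qj q - qj p * qim q + qk p * qre q).

Let qaddA : associative qadd.
Proof. by move=> [????][????][????]; congr Quat => /=; ring. Qed.
Let qaddC : commutative qadd.
Proof. by move=> [????][????]; congr Quat => /=; ring. Qed.
Let qadd0 : left_id (Quat 0 0 0 0) qadd.
Proof. by move=> [????]; congr Quat => /=; ring. Qed.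
Let qaddN : left_inverse (Quat 0 0 0 0) qopp qadd.
Proof. by move=> [????]; congr Quat => /=; ring. Qed.

HB.instance Definition _ :=
  GRing.isZmodule.Build (quat R) qaddA qaddC qadd0 qaddN.

Let qmulA : associative qmul.
Proof. by move=> [????][????][????]; congr Quat => /=; ring. Qed.
Let qmul1l : left_id (Quat 1 0 0 0) qmul.
Proof. by move=> [????]; congr Quat => /=; ring. Qed.
Let qmul1r : right_id (Quat 1 0 0 0) qmul.
Proof. by move=> [????]; congr Quat => /=; ring. Qed.
Let qmulDl : left_distributive qmul qadd.
Proof. by move=> [????][????][????]; congr Quat => /=; ring. Qed.
Let qmulDr : right_distributive qmul qadd.
Proof. by move=> [????][????][????]; congr Quat => /=; ring. Qed.
Let qoner_neq0 : Quat 1 0 0 0 != 0 :> quat R.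
Proof. by apply/eqP => /(congr1 (@qre R)) /= /eqP; rewrite oner_eq0. Qed.

HB.instance Definition _ := GRing.Zmodule_isNzRing.Build (quat R)
  qmulA qmul1l qmul1r qmulDl qmulDr qoner_neq0.

Definition qconj q := Quat (qre q) (- qim q) (- qj q) (- qk q).

(* The closed upper half-plane of C = span_R {1, i}. *)
Definition in_Cplus q := [/\ 0 <= qim q, qj q = 0 & qk q = 0].

End QuatRing.

(* The library's norm, topology and completeness are attached to real scalars;
   [rscale x q] is the right multiple x q, and [rscale_real] says that the real
   scalar multiplication is its restriction to R. [norm_inner] ties the norm
   (hence the topology) to the inner product. *)
HB.mixin Record isRightQHilbert (R : realType) H of CompleteNormedModule R H := {
  rscale : H -> quat R -> H;
  rscaleDl : forall (x y : H) (q : quat R),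
    rscale (x + y) q = rscale x q + rscale y q;
  rscaleDr : forall (x : H) (p q : quat R),
    rscale x (p + q) = rscale x p + rscale x q;
  rscaleA : forall (x : H) (p q : quat R),
    rscale (rscale x p) q = rscale x (p * q);
  rscale1 : forall x : H, rscale x 1 = x;
  rscale_real : forall (x : H) (a : R), rscale x (Quat a 0 0 0) = a *: x;
  inner : H -> H -> quat R;
  innerDl : forall x y z : H, inner (x + y) z = inner x z + inner y z;
  innerZl : forall (x z : H) (q : quat R),
    inner (rscale x q) z = inner x z * q;
  inner_conj : forall x y : H, inner x y = qconj (inner y x);
  inner_gt0 : forall x : H, x != 0 -> 0 < qre (inner x x);
  norm_inner : forall x : H, `|x| = Num.sqrt (qre (inner x x))
}.

#[short(type="rightQHilbertType")]
HB.structure Definition RightQHilbert (R : realType) :=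
  {H of isRightQHilbert R H & CompleteNormedModule R H}.

Section HilbertSpace.
Variables (R : realType) (H : rightQHilbertType R).
Implicit Types (T D U : H -> H) (e : nat -> H).

Definition separable_space := exists S : set H, countable S /\ dense S.

Definition right_span (I : finType) (v : I -> H) : set H :=
  [set x | exists c : I -> quat R, x = \sum_i rscale (v i) (c i)].

Definition infinite_dimensional :=
  forall (n : nat) (v : 'I_n -> H), right_span v <> setT.

Definition orthonormal_basis e :=
  (forall m n, inner (e m) (e n) = (m == n)%:R) /\
  dense (\bigcup_n right_span (fun k : 'I_n => e k)).

(* B(H) *)
Definition bounded_operator T :=
  (forall x y q, T (rscale x q + y) = rscale (T x) q + T y) /\
  exists M : R, forall x, `|T x| <= M * `|x|.

(* The supremum is finite exactly when [T] is bounded; on other maps it is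
   junk. *)
Definition opnorm T : R := sup [set `|T x| | x in [set x | `|x| <= 1]].

(* For [T] in B(H) the Riesz representation theorem makes z exist, uniquely,
   for every y; when no such z exists the value is 0. *)
Definition adjoint T (y : H) : H :=
  xget 0 [set z | forall x, inner (T x) y = inner x z].

Definition normal_operator T := adjoint T \o T = T \o adjoint T.

Definition unitary_operator U :=
  [/\ bounded_operator U, adjoint U \o U = idfun & U \o adjoint U = idfun].

Definition diagonal_operator D e (d : nat -> quat R) :=
  forall n, D (e n) = rscale (e n) (d n).

Definition approx_unitary_equiv T D :=
  exists U : nat -> H -> H,
    (forall n, unitary_operator (U n)) /\
    opnorm ((U n \o D \o adjoint (U n)) \- T) @[n --> \oo] --> 0.

End HilbertSpace.

Arguments separable_space {R} H.
Arguments infinite_dimensional {R} H.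

(* Main.v *)
Require Import Defs.
From HB Require Import structures.
From mathcomp Require Import finmap.
From mathcomp Require Import all_boot all_order all_algebra.
From mathcomp Require Import ring lra.
From mathcomp Require Import all_classical all_reals all_analysis.

(* Write T = A + B with A self-adjoint, B anti-self-adjoint, and Q = |B|. A
   self-adjoint S with |S| <= r has a sign s, a self-adjoint involution in its
   bicommutant with |S| = s S, and then |S - (r/2) s| <= r/2; iterating gives a
   binary expansion of S as a norm convergent sum of r 2^-k s_k. Expanding A and Q
   in this way yields a sequence of commuting involutions, whose joint eigenspaces
   form a binary tree of subspaces refining H. Each of them has an orthonormal
   basis of vectors x with B x = (Q x) i, on which T is close to a right
   multiplication by a number in the closed upper half-plane. Orthonormal bases of
   one space have the same cardinality, so each index can be assigned an infinite
   branch of the tree in such a way that, at every level, as many indices pass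
   through a node as the dimension of its subspace. The branches determine the
   eigenvalues d_n of D, and U_n carries a fixed basis to a basis adapted to the
   n-th level of the tree. *)

Set Implicit Arguments.
Unset Strict Implicit.
Unset Printing Implicit Defensive.

Import Order.TTheory GRing.Theory Num.Theory.
Import numFieldNormedType.Exports.

Local Open Scope classical_set_scope.
Local Open Scope ring_scope.

(** Right multiplication by [i] is not right linear, so complex eigenvalues cannot be used as scalar
    operators. Only the self-adjoint operators A and Q are expanded, with real coefficients; the
    imaginary unit enters through the choice of basis vectors. If Q x = x b and B x = (Q x) i, then
    B x = x (b i), and the positivity of Q is what puts the eigenvalue in the upper half-plane.

    The obstacle is that D must not depend on n, while a basis of common eigenvectors for all the
    involutions need not exist: with continuous spectrum, the subspaces along an infinite branch may
    intersect in 0. What can be fixed once and for all is the number of indices passing through each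
    node, a condition on dimensions alone. The vectors are chosen anew at each level, and the
    freedom to let U_n vary absorbs that choice. *)

Local Notation "x *q p" := (rscale x p) (at level 40).

(** * Quaternions and the inner product *)

Section Quaternions.
Variable R : realType.
Implicit Types p q : quat R.

(** The norm is kept squared, so that Parseval and Bessel need no square roots. *)
Definition qn q : R := qre q ^+ 2 + qim q ^+ 2 + qj q ^+ 2 + qk q ^+ 2.
Definition qr (a : R) : quat R := Quat a 0 0 0.
Definition qi : quat R := Quat 0 1 0 0.
Definition qjj : quat R := Quat 0 0 1 0.
Definition qc (a b : R) : quat R := Quat a b 0 0.

Lemma quatP p q : qre p = qre q -> qim p = qim q -> qj p = qj q ->
  qk p = qk q -> p = q.
Proof. by case: p q => [????] [????] /= -> -> -> ->. Qed.

Lemma qconjK : involutive (@qconj R).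
Proof. by case=> a b c d; rewrite /qconj /= !opprK. Qed.

Lemma qconjD p q : qconj (p + q) = qconj p + qconj q.
Proof. by apply: quatP => //=; rewrite opprD. Qed.

Lemma qconjM p q : qconj (p * q) = qconj q * qconj p.
Proof. by apply: quatP => /=; ring. Qed.

Lemma qconj0 : qconj 0 = 0 :> quat R.
Proof. by apply: quatP => //=; rewrite oppr0. Qed.

Lemma qconjN p : qconj (- p) = - qconj p.
Proof. by apply: quatP. Qed.

Lemma qre_rM p (a : R) : qre (p * qr a) = qre p * a.
Proof. by rewrite /=; ring. Qed.

Lemma qn_ge0 q : 0 <= qn q.
Proof. by rewrite !addr_ge0 ?sqr_ge0. Qed.

Lemma qn_conj q : qn (qconj q) = qn q.
Proof. by rewrite /qn /= !sqrrN. Qed.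

Lemma qnM p q : qn (p * q) = qn p * qn q.
Proof. by rewrite /qn /=; ring. Qed.

Lemma qn1 : qn 1 = 1.
Proof. by rewrite /qn /=; ring. Qed.

Lemma qn_qi : qn qi = 1.
Proof. by rewrite /qn /=; ring. Qed.

Lemma qn_qc (a b : R) : qn (qc a b) = a ^+ 2 + b ^+ 2.
Proof. by rewrite /qn /=; ring. Qed.

Lemma qM_mid p (a : R) q : qconj q * (qr a) * q = qr (a * qn q).
Proof. by apply: quatP; rewrite /qn /=; ring. Qed.

Lemma qii : qi * qi = qr (- 1).
Proof. by apply: quatP => /=; ring. Qed.

End Quaternions.

Arguments qi {R}.
Arguments qjj {R}.

Section InnerProduct.
Variables (R : realType) (H : rightQHilbertType R).
Implicit Types (x y z : H) (q : quat R) (a : R).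

Lemma rscale0 x : x *q 0 = 0.
Proof. by apply: (addrI (x *q 0)); rewrite -rscaleDr !addr0. Qed.

Lemma rscale0l q : (0 : H) *q q = 0.
Proof. by apply: (addrI ((0 : H) *q q)); rewrite -rscaleDl !addr0. Qed.

Lemma rscaleN x q : x *q (- q) = - (x *q q).
Proof. by apply: (addrI (x *q q)); rewrite -rscaleDr !subrr rscale0. Qed.

Lemma rscaleNl x q : (- x) *q q = - (x *q q).
Proof. by apply: (addrI (x *q q)); rewrite -rscaleDl !subrr rscale0l. Qed.

Lemma rscaleBl x y q : (x - y) *q q = x *q q - y *q q.
Proof. by rewrite rscaleDl rscaleNl. Qed.

Lemma rscaleBr x p q : x *q (p - q) = x *q p - x *q q.
Proof. by rewrite rscaleDr rscaleN. Qed.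

Lemma rscale_r x a : x *q qr a = a *: x.
Proof. exact: rscale_real. Qed.

Lemma rscaleZ a x q : (a *: x) *q q = a *: (x *q q).
Proof.
rewrite -!rscale_r !rscaleA; congr (_ *q _); apply: quatP => /=; ring.
Qed.

Lemma inner0l y : inner (0 : H) y = 0.
Proof. by rewrite -(rscale0 0) innerZl mulr0. Qed.

Lemma inner0r x : inner x (0 : H) = 0.
Proof. by rewrite inner_conj inner0l qconj0. Qed.

Lemma innerNl x y : inner (- x) y = - inner x y.
Proof. by apply: (addrI (inner x y)); rewrite -innerDl !subrr inner0l. Qed.

Lemma innerBl x y z : inner (x - y) z = inner x z - inner y z.
Proof. by rewrite innerDl innerNl. Qed.

Lemma innerDr x y z : inner x (y + z) = inner x y + inner x z.
Proof. by rewrite inner_conj innerDl qconjD -!inner_conj. Qed.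

Lemma innerNr x y : inner x (- y) = - inner x y.
Proof. by rewrite inner_conj innerNl qconjN -inner_conj. Qed.

Lemma innerBr x y z : inner x (y - z) = inner x y - inner x z.
Proof. by rewrite innerDr innerNr. Qed.

Lemma innerZr x y q : inner x (y *q q) = qconj q * inner x y.
Proof. by rewrite inner_conj innerZl qconjM -inner_conj. Qed.

Lemma innerZZ x y p q :
  inner (x *q p) (y *q q) = qconj q * inner x y * p.
Proof. by rewrite innerZr innerZl mulrA. Qed.

Lemma inner_suml (I : Type) (r : seq I) (P : pred I) (F : I -> H) y :
  inner (\sum_(i <- r | P i) F i) y = \sum_(i <- r | P i) inner (F i) y.
Proof.
apply: (big_morph (fun x => inner x y)); first by move=> x z; rewrite innerDl.
exact: inner0l.
Qed.

Lemma inner_sumr (I : Type) (r : seq I) (P : pred I) (F : I -> H) y :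
  inner y (\sum_(i <- r | P i) F i) = \sum_(i <- r | P i) inner y (F i).
Proof.
apply: (big_morph (fun x => inner y x)); first by move=> x z; rewrite innerDr.
exact: inner0r.
Qed.

Lemma inner_eq0C x y : inner x y = 0 -> inner y x = 0.
Proof. by rewrite inner_conj => e; rewrite -[LHS]qconjK e qconj0. Qed.

(** A symmetric real inner product inducing the same norm; norm estimates and limits are carried out
    with it, and [inner_eqP] returns to quaternions. *)
Definition ip x y : R := qre (inner x y).

Lemma ipC x y : ip x y = ip y x.
Proof. by rewrite /ip inner_conj. Qed.
Lemma ipDl x y z : ip (x + y) z = ip x z + ip y z.
Proof. by rewrite /ip innerDl. Qed.
Lemma ipDr x y z : ip x (y + z) = ip x y + ip x z.
Proof. by rewrite /ip innerDr. Qed.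
Lemma ipNl x y : ip (- x) y = - ip x y.
Proof. by rewrite /ip innerNl. Qed.
Lemma ipNr x y : ip x (- y) = - ip x y.
Proof. by rewrite /ip innerNr. Qed.
Lemma ipBl x y z : ip (x - y) z = ip x z - ip y z.
Proof. by rewrite ipDl ipNl. Qed.
Lemma ipBr x y z : ip x (y - z) = ip x y - ip x z.
Proof. by rewrite ipDr ipNr. Qed.
Lemma ipZl a x y : ip (a *: x) y = a * ip x y.
Proof. by rewrite /ip -rscale_r innerZl qre_rM mulrC. Qed.
Lemma ipZr a x y : ip x (a *: y) = a * ip x y.
Proof. by rewrite ipC ipZl ipC. Qed.
Lemma ip0l y : ip 0 y = 0. Proof. by rewrite /ip inner0l. Qed.
Lemma ip0r y : ip y 0 = 0. Proof. by rewrite /ip inner0r. Qed.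

Lemma ip_ge0 x : 0 <= ip x x.
Proof.
have [->|/inner_gt0/ltW//] := eqVneq x 0; by rewrite ip0l.
Qed.

Lemma normE2 x : `|x| ^+ 2 = ip x x.
Proof. by rewrite norm_inner sqr_sqrtr // ip_ge0. Qed.

Lemma innerxx x : inner x x = qr (`|x| ^+ 2).
Proof.
rewrite normE2 /ip; have := inner_conj x x; case: (inner x x) => a b c d.
by rewrite /qconj /qr /= => -[] *; congr Quat; lra.
Qed.

Lemma inner_eq0 x : inner x x = 0 -> x = 0.
Proof.
rewrite innerxx => -[] /eqP; rewrite sqrf_eq0 => /eqP/normr0_eq0 //.
Qed.

Lemma norm_rscale x q : `|x *q q| ^+ 2 = `|x| ^+ 2 * qn q.
Proof. by rewrite normE2 /ip innerZZ innerxx qM_mid. Qed.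

(* The entries of [inner x y] are the real inner products of right multiples of
   [x] with [y]. *)
Lemma inner_eqP x y x' y' : (forall q, ip (x *q q) y = ip (x' *q q) y') ->
  inner x y = inner x' y'.
Proof.
move=> h; have h1 := h 1; have h2 := h qi; have h3 := h qjj.
have h4 := h (Quat 0 0 0 1).
move: h1 h2 h3 h4; rewrite /ip !innerZl.
case: (inner x y) (inner x' y') => a b c d [a' b' c' d'] /=.
by move=> *; apply: quatP => /=; lra.
Qed.

Lemma inner_eq0P x y : (forall q, ip (x *q q) y = 0) -> inner x y = 0.
Proof.
move=> h; rewrite -(inner0l y); apply: inner_eqP => q.
by rewrite h rscale0l ip0l.
Qed.

Lemma normD2 x y : `|x + y| ^+ 2 = `|x| ^+ 2 + 2 * ip x y + `|y| ^+ 2.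
Proof. rewrite !normE2 ipDl !ipDr (ipC y x); ring. Qed.

Lemma normB2 x y : `|x - y| ^+ 2 = `|x| ^+ 2 - 2 * ip x y + `|y| ^+ 2.
Proof. rewrite normD2 ipNr normrN; ring. Qed.

Lemma normZ2 a x : `|a *: x| ^+ 2 = a ^+ 2 * `|x| ^+ 2.
Proof. by rewrite !normE2 ipZl ipZr; ring. Qed.

(** Cauchy-Schwarz, by expanding the square of the norm of [|y| x - |x| y]. *)
Lemma ip_le x y : ip x y <= `|x| * `|y|.
Proof.
have [->|x0] := eqVneq x 0; first by rewrite ip0l mulr_ge0.
have [->|y0] := eqVneq y 0; first by rewrite ip0r mulr_ge0.
have hx : 0 < `|x| by rewrite normr_gt0.
have hy : 0 < `|y| by rewrite normr_gt0.
have := sqr_ge0 (`| `|y| *: x - `|x| *: y|).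
rewrite normB2 !normZ2 ipZl ipZr => h.
have : 0 <= 2 * (`|x| * `|y|) * (`|x| * `|y| - ip x y) by move: h; lra.
by rewrite pmulr_rge0 ?subr_ge0 // !mulr_gt0.
Qed.

Lemma ip_abs x y : `|ip x y| <= `|x| * `|y|.
Proof. by rewrite ler_norml ip_le andbT lerNl -ipNl -(normrN x) ip_le. Qed.

Lemma le_norm2 x (c : R) : 0 <= c -> `|x| ^+ 2 <= c ^+ 2 -> `|x| <= c.
Proof. by move=> c0; rewrite ler_pXn2r // nnegrE. Qed.

End InnerProduct.

(** * Bounded operators *)

Section BoundedOperators.
Variables (R : realType) (H : rightQHilbertType R).
Implicit Types (x y z : H) (q : quat R) (a : R) (T S X : H -> H).
Implicit Types (u v : nat -> H).

Definition lin T := forall x y q, T (x *q q + y) = T x *q q + T y.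
Definition bnd (M : R) T := forall x, `|T x| <= M * `|x|.
(** A relation rather than the function [adjoint], so that sums and compositions of adjoints are
    computed without an existence proof; [adjointE] links the two. *)
Definition adj X X' := forall x y, inner (X x) y = inner x (X' y).
Definition comm S T := forall x, S (T x) = T (S x).

Lemma linD T : lin T -> forall x y, T (x + y) = T x + T y.
Proof. by move=> h x y; rewrite -{1}(rscale1 x) h rscale1. Qed.
Lemma lin0 T : lin T -> T 0 = 0.
Proof. by move=> h; apply: (addrI (T 0)); rewrite -linD // !addr0. Qed.
Lemma linS T : lin T -> forall x q, T (x *q q) = T x *q q.
Proof. by move=> h x q; rewrite -[x *q q]addr0 h lin0 // addr0. Qed.
Lemma linN T : lin T -> forall x, T (- x) = - T x.
Proof. by move=> h x; apply: (addrI (T x)); rewrite -linD // !subrr lin0. Qed.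
Lemma linB T : lin T -> forall x y, T (x - y) = T x - T y.
Proof. by move=> h x y; rewrite linD // linN. Qed.
Lemma linZ T : lin T -> forall a x, T (a *: x) = a *: T x.
Proof. by move=> h a x; rewrite -!rscale_r linS. Qed.
Lemma lin_sum T : lin T -> forall (I : Type) (r : seq I) (P : pred I) (F : I -> H),
  T (\sum_(i <- r | P i) F i) = \sum_(i <- r | P i) T (F i).
Proof.
move=> h I r P F; apply: (big_morph T); last exact: lin0.
by move=> x y; rewrite linD.
Qed.

Lemma bnd_bop (M : R) T : lin T -> bnd M T -> bounded_operator T.
Proof. by move=> hl hb; split=> [x y q|]; [exact: hl|exists M]. Qed.

Lemma bop_lin T : bounded_operator T -> lin T.
Proof. by case. Qed.

Lemma bop_bnd T : bounded_operator T -> exists2 M : R, 0 < M & bnd M T.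
Proof.
case=> _ [M hM]; exists (`|M| + 1) => [|x]; first by rewrite ltr_wpDl.
apply: (le_trans (hM x)); apply: ler_wpM2r => //.
by apply: (le_trans (ler_norm M)); rewrite lerDl.
Qed.

Lemma bop_id : bounded_operator (@idfun H).
Proof. by split=> [//|]; exists 1 => x; rewrite mul1r. Qed.

Lemma bop_comp S T : bounded_operator S -> bounded_operator T ->
  bounded_operator (fun x => S (T x)).
Proof.
move=> hS hT; have [M M0 hM] := bop_bnd hS; have [N N0 hN] := bop_bnd hT.
have lS := bop_lin hS; have lT := bop_lin hT.
apply: (@bnd_bop (M * N)) => [x y q|x]; first by rewrite lT lS.
by apply: (le_trans (hM _)); rewrite -mulrA ler_pM2l.
Qed.

Lemma bop_add S T : bounded_operator S -> bounded_operator T ->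
  bounded_operator (fun x => S x + T x).
Proof.
move=> hS hT; have [M M0 hM] := bop_bnd hS; have [N N0 hN] := bop_bnd hT.
have lS := bop_lin hS; have lT := bop_lin hT.
apply: (@bnd_bop (M + N)) => [x y q|x].
  by rewrite lT lS rscaleDl addrACA.
by rewrite mulrDl; apply: (le_trans (ler_normD _ _)); apply: lerD.
Qed.

Lemma bop_scale a T : bounded_operator T -> bounded_operator (fun x => a *: T x).
Proof.
move=> hT; have [N N0 hN] := bop_bnd hT; have lT := bop_lin hT.
apply: (@bnd_bop (`|a| * N)) => [x y q|x].
  by rewrite lT scalerDr rscaleZ.
by rewrite normrZ -mulrA ler_wpM2l.
Qed.

Lemma bop_opp T : bounded_operator T -> bounded_operator (fun x => - T x).
Proof.
move=> hT; have [N N0 hN] := bop_bnd hT; have lT := bop_lin hT.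
apply: (@bnd_bop N) => [x y q|x]; last by rewrite normrN.
by rewrite lT opprD rscaleNl.
Qed.

Lemma bop_sub S T : bounded_operator S -> bounded_operator T ->
  bounded_operator (fun x => S x - T x).
Proof. by move=> hS hT; apply: bop_add => //; apply: bop_opp. Qed.

Lemma adj_sym X X' : adj X X' -> adj X' X.
Proof. by move=> h x y; rewrite inner_conj -h -inner_conj. Qed.

Lemma adj_ip X X' : adj X X' -> forall x y, ip (X x) y = ip x (X' y).
Proof. by move=> h x y; rewrite /ip h. Qed.

Lemma adj_inj X X' Y : adj X X' -> adj X Y -> X' =1 Y.
Proof.
move=> h1 h2 y; apply/eqP; rewrite -subr_eq0; apply/eqP/inner_eq0.
by rewrite innerBr -h1 -h2 subrr.
Qed.

Lemma adj_add X X' Y Y' : adj X X' -> adj Y Y' ->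
  adj (fun x => X x + Y x) (fun x => X' x + Y' x).
Proof. by move=> h h' x y; rewrite innerDl innerDr h h'. Qed.

Lemma adj_sub X X' Y Y' : adj X X' -> adj Y Y' ->
  adj (fun x => X x - Y x) (fun x => X' x - Y' x).
Proof. by move=> h h' x y; rewrite innerBl innerBr h h'. Qed.

Lemma adj_comp X X' Y Y' : adj X X' -> adj Y Y' ->
  adj (fun x => X (Y x)) (fun x => Y' (X' x)).
Proof. by move=> h h' x y; rewrite h h'. Qed.

Lemma adj_scale a X X' : adj X X' -> adj (fun x => a *: X x) (fun x => a *: X' x).
Proof.
move=> h x y; rewrite -!rscale_r innerZl innerZr h.
by apply: quatP => /=; ring.
Qed.

Lemma adj_id : adj (@idfun H) idfun. Proof. by []. Qed.

Lemma adjointE X X' : adj X X' -> adjoint X = X'.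
Proof.
move=> h; apply/funext => y; apply/esym.
rewrite /adjoint; case: xgetP => [z _ hz|/(_ (X' y))]; last by case => x; rewrite h.
apply/eqP; rewrite -subr_eq0; apply/eqP/inner_eq0.
by rewrite innerBr -hz h subrr.
Qed.

Lemma cvg_ip u l x : u @ \oo --> l -> (fun n => ip (u n) x) @ \oo --> ip l x.
Proof.
move=> /cvgrPdist_le h; apply/cvgrPdist_le => e e0.
have c0 : 0 < `|x| + 1 by rewrite ltr_wpDl.
have /h : 0 < e / (`|x| + 1) by rewrite divr_gt0.
apply: filterS => n hn; rewrite -ipBl; apply: (le_trans (ip_abs _ _)).
apply: (@le_trans _ _ (`|l - u n| * (`|x| + 1))).
  by apply: ler_wpM2l => //; rewrite lerDl.
by rewrite -ler_pdivlMr.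
Qed.

Lemma cvg_bnd T (M : R) u l : lin T -> bnd M T -> u @ \oo --> l ->
  (fun n => T (u n)) @ \oo --> T l.
Proof.
move=> lT hM /cvgrPdist_le h; apply/cvgrPdist_le => e e0.
have c0 : 0 < `|M| + 1 by rewrite ltr_wpDl.
have /h : 0 < e / (`|M| + 1) by rewrite divr_gt0.
apply: filterS => n hn; rewrite -linB //; apply: (le_trans (hM _)).
apply: (@le_trans _ _ ((`|M| + 1) * `|l - u n|)).
  by apply: ler_wpM2r => //; apply: (le_trans (ler_norm M)); rewrite lerDl.
by rewrite mulrC -ler_pdivlMr.
Qed.

Lemma cvg_bop T u l : bounded_operator T -> u @ \oo --> l ->
  (fun n => T (u n)) @ \oo --> T l.
Proof. by move=> hT; have [M _ hM] := bop_bnd hT; apply: cvg_bnd hM; apply: bop_lin. Qed.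

Lemma cvg_rscale u l q : u @ \oo --> l -> (fun n => u n *q q) @ \oo --> l *q q.
Proof.
move=> /cvgrPdist_le h; apply/cvgrPdist_le => e e0.
(* [qn q] is the square of the factor by which the norm grows, and it is at most the square of
   [qn q + 1]. *)
have c0 : 0 < qn q + 1 by rewrite ltr_wpDl // qn_ge0.
have /h : 0 < e / (qn q + 1) by rewrite divr_gt0.
apply: filterS => n hn; rewrite -rscaleBl.
rewrite ler_pdivlMr // in hn; apply: le_trans hn; apply: le_norm2.
  by rewrite mulr_ge0 // ltW.
rewrite norm_rscale exprMn ler_wpM2l ?sqr_ge0 //.
by rewrite sqrrD1; have := sqr_ge0 (qn q); have := qn_ge0 q; lra.
Qed.

Lemma cvg_eq u (l l' : H) : u @ \oo --> l -> u @ \oo --> l' -> l = l'.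
Proof.
move=> h h'; rewrite -(cvg_lim (@norm_hausdorff _ _) h).
exact: (cvg_lim (@norm_hausdorff _ _) h').
Qed.

Lemma cvg_norm_le u l (c : R) : u @ \oo --> l -> (forall n, `|u n| <= c) -> `|l| <= c.
Proof.
move=> h hc; have hn : (fun n => `|u n|) @ \oo --> `|l| by apply: cvg_norm.
rewrite -(cvg_lim (@norm_hausdorff _ _) hn).
by apply: limr_le; [exact: cvgP hn|exact: nearW].
Qed.

Lemma cvg_ip_eq0 u l x : u @ \oo --> l -> (forall n, ip (u n) x = 0) -> ip l x = 0.
Proof.
move=> /(@cvg_ip _ _ x) h h0; rewrite -(cvg_lim (@norm_hausdorff _ _) h).
rewrite (_ : (fun n => ip (u n) x) = fun=> 0); last exact/funext.
exact: (lim_cst (@norm_hausdorff _ _)).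
Qed.

(** The hypothesis makes [s] monotone, hence convergent, and [u] inherits the Cauchy property. It
    serves orthogonal series, where [s] comes from Pythagoras, and the iteration for the square
    root. *)
Lemma cvg_majorant u (s : nat -> R) (c : R) :
  (forall m n, (n <= m)%N -> `|u m - u n| ^+ 2 <= s m - s n) ->
  (forall n, s n <= c) -> cvgn u.
Proof.
move=> hu hc; have smon : {homo s : n m / (n <= m)%N >-> n <= m}.
  by move=> n m /hu h; rewrite -subr_ge0; apply: le_trans h; apply: sqr_ge0.
have cs : cvgn s.
  by apply: nondecreasing_is_cvgn => //; exists c => _ [n _ <-].
apply/cauchy_cvgP/cauchy_exP => e e0.
move: (cs) => /cvgrPdist_lt /(_ (e ^+ 2)); rewrite exprn_gt0 // => /(_ isT) [N _ hN].
exists (u N); exists N => // n /= Nn.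
rewrite -ball_normE /= -normrN opprB -(ltr_pXn2r (n := 2)) ?nnegrE ?(ltW e0) //.
apply: (le_lt_trans (hu _ _ Nn)).
have := hN N (leqnn N); rewrite ger0_norm; last first.
  by rewrite subr_ge0; apply: nondecreasing_cvgn_le.
by apply: le_lt_trans; rewrite lerD2r; apply: nondecreasing_cvgn_le.
Qed.

Lemma near0_eq0 x : (forall e : R, 0 < e -> `|x| <= e) -> x = 0.
Proof.
move=> h; apply/eqP; rewrite -normr_le0; apply/ler_addgt0Pl => e e0.
by rewrite addr0 h.
Qed.

End BoundedOperators.

(** * Orthonormal families *)

Section OrthonormalFamilies.
Variables (R : realType) (H : rightQHilbertType R).
Implicit Types (x y z : H) (q : quat R) (S T : H -> H) (V W : set H).

(* Zero vectors are allowed, so that Gram-Schmidt needs no case distinction. *)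
Definition pon (I : eqType) (g : I -> H) :=
  (forall i j, i != j -> inner (g i) (g j) = 0) /\
  (forall i, g i = 0 \/ inner (g i) (g i) = 1).

Definition csub V := [/\ V 0, forall x y, V x -> V y -> V (x + y),
  forall x q, V x -> V (x *q q) &
  forall (u : nat -> H) l, (forall n, V (u n)) -> u @ \oo --> l -> V l].

Definition total (I : Type) (g : I -> H) V :=
  forall x, V x -> (forall i, inner x (g i) = 0) -> x = 0.

Lemma csub_sum V : csub V -> forall (I : eqType) (r : seq I) (F : I -> H),
  (forall i, i \in r -> V (F i)) -> V (\sum_(i <- r) F i).
Proof.
move=> [V0 VD _ _] I r F h; rewrite big_seq.
by apply: big_ind.
Qed.

Lemma csubN V x : csub V -> V x -> V (- x).
Proof. by move=> [_ _ VS _] /(VS _ (- 1)); rewrite rscaleN rscale1. Qed.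

Lemma csubB V x y : csub V -> V x -> V y -> V (x - y).
Proof. by move=> hV hx hy; case: (hV) => _ VD _ _; apply: VD => //; apply: csubN. Qed.

Lemma csub_eq (S T : H -> H) : bounded_operator S -> bounded_operator T ->
  csub [set x | S x = T x].
Proof.
move=> hS hT; have lS := bop_lin hS; have lT := bop_lin hT.
split=> [|x y /= hx hy|x q /= hx|u l /= hu ul].
- by rewrite /= !lin0.
- by rewrite !linD // hx hy.
- by rewrite !linS // hx.
have h1 := cvg_bop hS ul; have h2 := cvg_bop hT ul.
rewrite -(cvg_lim (@norm_hausdorff _ _) h1) -(cvg_lim (@norm_hausdorff _ _) h2).
by congr (limn _); apply/funext.
Qed.

(** Together with [total_sub] this reduces an identity between inner products to the vectors of a
    basis. *)
Lemma csub_inner_eq S y z : bounded_operator S ->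
  csub [set x | inner (S x) y = inner x z].
Proof.
move=> hS; have lS := bop_lin hS.
split=> [|a b /= ha hb|a q /= ha|u l /= hu ul] /=.
- by rewrite (lin0 lS) !inner0l.
- by rewrite (linD lS) !innerDl ha hb.
- by rewrite (linS lS) !innerZl ha.
apply: inner_eqP => q.
have h1 := cvg_ip (x := y) (cvg_rscale (q := q) (cvg_bop hS ul)).
have h2 := cvg_ip (x := z) (cvg_rscale (q := q) ul).
rewrite -(cvg_lim (@norm_hausdorff _ _) h1) -(cvg_lim (@norm_hausdorff _ _) h2).
by congr (limn _); apply/funext => n; rewrite /ip !innerZl hu.
Qed.

Lemma csubI V W : csub V -> csub W -> csub (V `&` W).
Proof.
move=> [V0 VD VS Vl] [W0 WD WS Wl]; split.
- by [].
- by move=> x y [? ?] [? ?]; split; [exact: VD|exact: WD].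
- by move=> x q [? ?]; split; [exact: VS|exact: WS].
by move=> u l h ul; split; [apply: Vl ul => n|apply: Wl ul => n]; case: (h n).
Qed.

Lemma csubT : csub setT.
Proof. by []. Qed.

Section Finite.
Variables (I : eqType) (g : I -> H).
Hypothesis hg : pon g.
Implicit Types (c : I -> quat R) (r : seq I).

Lemma pon_inner_out r c k : k \notin r ->
  inner (\sum_(i <- r) g i *q c i) (g k) = 0.
Proof.
move=> kr; rewrite inner_suml big_seq big1 // => i ir.
rewrite innerZl (proj1 hg) ?mul0r //.
by apply: contraNneq kr => <-.
Qed.

Lemma pon_inner r c k : uniq r -> k \in r ->
  inner (\sum_(i <- r) g i *q c i) (g k) = inner (g k) (g k) * c k.
Proof.
move=> ur kr; rewrite (big_rem k) //= innerDl innerZl pon_inner_out ?addr0 //.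
by rewrite mem_rem_uniqF.
Qed.

Lemma pon_norm r c : uniq r ->
  `|\sum_(i <- r) g i *q c i| ^+ 2 = \sum_(i <- r) `|g i| ^+ 2 * qn (c i).
Proof.
elim: r => [|k r IH] /=; first by rewrite !big_nil normr0 expr0n.
case/andP=> kr ur; rewrite !big_cons normD2 IH // norm_rscale.
by rewrite ipC /ip innerZr pon_inner_out // mulr0 mulr0 addr0.
Qed.

Lemma pon_fourier x k :
  inner (g k) (g k) * inner x (g k) = inner x (g k).
Proof. by case: (proj2 hg k) => ->; rewrite ?inner0r ?mul0r ?mul1r. Qed.

Lemma pon_orth_out x r k : uniq r -> k \in r ->
  inner (x - \sum_(i <- r) g i *q inner x (g i)) (g k) = 0.
Proof. by move=> ur kr; rewrite innerBl pon_inner // pon_fourier subrr. Qed.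

Lemma bessel r x : uniq r ->
  `|\sum_(i <- r) g i *q inner x (g i)| <= `|x|.
Proof.
move=> ur; set y := \sum_(i <- r) _; apply: le_norm2 => //.
have h : ip (x - y) y = 0.
  rewrite /ip {2}/y inner_sumr big_seq big1 // => i ir.
  by rewrite innerZr pon_orth_out // mulr0.
rewrite -[x](subrK y) normD2 h mulr0 addr0 lerDr sqr_ge0 //.
Qed.

Lemma pon_norm_le i : `|g i| <= 1.
Proof.
case: (proj2 hg i) => [->|h]; first by rewrite normr0.
by apply: le_norm2 => //; rewrite normE2 /ip h expr1n.
Qed.

Lemma pon_unit i : g i <> 0 -> inner (g i) (g i) = 1.
Proof. by case: (proj2 hg i). Qed.

End Finite.

(** * Fourier series with respect to a partial orthonormal sequence *)

Section Series.
Variable g : nat -> H.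
Hypothesis hg : pon g.
Implicit Types (c : nat -> quat R).

Definition psum c n : H := \sum_(0 <= i < n) g i *q c i.
Definition fsum c : H := limn (psum c).

Lemma psum_cvg c (C : R) : (forall n, `|psum c n| <= C) ->
  psum c @ \oo --> fsum c.
Proof.
move=> hC; have C0 : 0 <= C by apply: le_trans (hC 0).
apply: (@cvg_majorant _ _ _ (fun n => `|psum c n| ^+ 2) (C ^+ 2)) => [m n nm|n].
  have -> : psum c m - psum c n = \sum_(n <= i < m) g i *q c i.
    by rewrite /psum (@big_cat_nat _ _ _ n 0 m) //= addrAC subrr add0r.
  rewrite /psum !(pon_norm hg) ?iota_uniq //.
  by rewrite [in leRHS](@big_cat_nat _ _ _ n 0 m) //= addrAC subrr add0r.
by rewrite ler_sqr ?nnegrE.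
Qed.

Lemma fsum_inner c (C : R) k : (forall n, `|psum c n| <= C) ->
  inner (fsum c) (g k) = inner (g k) (g k) * c k.
Proof.
move=> hC; have h := psum_cvg hC.
apply/eqP; rewrite -subr_eq0 -innerZl -innerBl; apply/eqP/inner_eq0P => q.
(* From index [k.+1] on, every partial sum contains the [k]-th term, so each member of the shifted
   sequence is already orthogonal to [g k]. *)
have h' : (fun n => (psum c (n + k.+1) - g k *q c k) *q q) @ \oo -->
    (fsum c - g k *q c k) *q q.
  apply: cvg_rscale; apply: cvgB; last exact: cvg_cst.
  by rewrite (cvg_shiftn _ (psum c)).
apply: (cvg_ip_eq0 h') => n; rewrite /ip innerZl innerBl pon_inner ?iota_uniq //.
  by rewrite innerZl subrr mul0r.
by rewrite mem_index_iota /= addnS ltnS leq_addl.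
Qed.

Lemma fsum_norm c (C : R) : (forall n, `|psum c n| <= C) -> `|fsum c| <= C.
Proof. by move=> hC; apply: (cvg_norm_le (psum_cvg hC)). Qed.

Lemma fsum_csub V c (C : R) : csub V -> (forall k, V (g k)) ->
  (forall n, `|psum c n| <= C) -> V (fsum c).
Proof.
move=> hV Vg hC; case: (hV) => _ _ VS Vl; apply: Vl (psum_cvg hC) => n.
by apply: csub_sum => // i _; apply: VS.
Qed.

Definition proj x : H := fsum (fun k => inner x (g k)).

Lemma proj_cvg x : psum (fun k => inner x (g k)) @ \oo --> proj x.
Proof. by apply: (@psum_cvg _ `|x|) => n; apply: bessel => //; rewrite iota_uniq. Qed.

Lemma proj_norm x : `|proj x| <= `|x|.
Proof. by apply: fsum_norm => n; apply: bessel => //; rewrite iota_uniq. Qed.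

Lemma proj_orth x k : inner (x - proj x) (g k) = 0.
Proof.
rewrite innerBl (@fsum_inner _ `|x|) ?pon_fourier ?subrr // => n.
by apply: bessel => //; rewrite iota_uniq.
Qed.

Lemma proj_csub V x : csub V -> (forall k, V (g k)) -> V (proj x).
Proof.
move=> hV Vg; apply: (@fsum_csub _ _ `|x|) => // n.
by apply: bessel => //; rewrite iota_uniq.
Qed.

Lemma total_proj V x : csub V -> (forall k, V (g k)) -> total g V ->
  V x -> proj x = x.
Proof.
move=> hV Vg ht Vx; apply/esym/eqP; rewrite -subr_eq0; apply/eqP/ht.
  by apply: csubB => //; apply: proj_csub.
exact: proj_orth.
Qed.

(** Extension from a basis: each vector of [V] is the limit of its Fourier sums, which lie in
    [W]. *)
Lemma total_sub V W : csub V -> (forall k, V (g k)) -> total g V ->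
  csub W -> (forall k, W (g k)) -> V `<=` W.
Proof.
by move=> hV Vg ht hW Wg x Vx; rewrite -(total_proj hV Vg ht Vx); apply: proj_csub.
Qed.

End Series.

(** At zero the value is zero, the degenerate case that [pon] admits. *)
Definition unitize x : H := `|x|^-1 *: x.

Lemma unitizeK x : `|x| *: unitize x = x.
Proof.
have [->|x0] := eqVneq x 0; first by rewrite normr0 scale0r.
by rewrite /unitize scalerA mulfV ?scale1r // normr_eq0.
Qed.

Lemma unitize_unit x : unitize x = 0 \/ inner (unitize x) (unitize x) = 1.
Proof.
have [->|x0] := eqVneq x 0; first by left; rewrite /unitize scaler0.
right; rewrite innerxx normrZ normfV normr_id mulVf ?normr_eq0 //.
by rewrite expr1n.
Qed.

Lemma gram_schmidt (u : nat -> H) : exists2 g : nat -> H, pon g &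
  forall n, g n = unitize (u n - \sum_(0 <= i < n) g i *q inner (u n) (g i)).
Proof.
(* Course-of-values recursion: [G n] holds the final vectors at the indices below [n], and [step n]
   writes entry [n] only. *)
pose step n (f : nat -> H) m := if m == n then
  unitize (u n - \sum_(0 <= i < n) f i *q inner (u n) (f i)) else f m.
pose G := fix G n := if n is n'.+1 then step n' (G n') else fun=> 0.
pose g m := G m.+1 m.
have Gg n m : (m < n)%N -> G n m = g m.
  elim: n => // n IH; rewrite ltnS leq_eqVlt => /orP[/eqP-> //|mn].
  by rewrite /= /step ltn_eqF // IH.
have gE n : g n = unitize (u n - \sum_(0 <= i < n) g i *q inner (u n) (g i)).
  rewrite {1}/g /= /step eqxx; congr (unitize (_ - _)).
  by rewrite !big_nat; apply: eq_bigr => i /andP[_ hi]; rewrite Gg.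
exists g => //; split=> [|i]; last by rewrite gE; apply: unitize_unit.
have key n : forall m, (m < n)%N -> inner (g n) (g m) = 0.
  elim/ltn_ind: n => n IH m mn.
  have orth i j : (i < n)%N -> (j < n)%N -> i != j -> inner (g i) (g j) = 0.
    move=> hi hj; rewrite neq_ltn => /orP[ij|ji]; last exact: IH.
    by apply: inner_eq0C; apply: IH.
  rewrite gE /unitize -rscale_r innerZl innerBl inner_suml.
  rewrite (bigD1_seq m) ?mem_index_iota ?iota_uniq //= innerZl.
  rewrite big_nat_cond big1 => [|i /andP[/andP[_ hi] im]]; last first.
    by rewrite innerZl orth // mul0r.
  rewrite addr0; have [->|->] : g m = 0 \/ inner (g m) (g m) = 1.
  - by rewrite gE; apply: unitize_unit.
  - by rewrite !inner0r mul0r subrr mul0r.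
  by rewrite mul1r subrr mul0r.
move=> i j; rewrite neq_ltn => /orP[ij|ji]; last exact: key.
by apply: inner_eq0C; apply: key.
Qed.

Lemma gram_schmidt_orth (u g : nat -> H) :
  (forall n, g n = unitize (u n - \sum_(0 <= i < n) g i *q inner (u n) (g i))) ->
  forall x, (forall n, inner x (g n) = 0) -> forall n, inner x (u n) = 0.
Proof.
move=> gE x hx n; set s := \sum_(0 <= i < n) g i *q inner (u n) (g i).
have -> : u n = (u n - s) + s by rewrite subrK.
rewrite -[u n - s]unitizeK -gE innerDr -rscale_r innerZr hx mulr0 add0r.
by rewrite inner_sumr big1 // => i _; rewrite innerZr hx mulr0.
Qed.

(** [V] is not assumed to be a right subspace: closure under the coefficients [inner x y] suffices.
    In [adapted_basis] it is the range of [adapt], where these coefficients are complex. *)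
Lemma gram_schmidt_mem (u g : nat -> H) V :
  (forall n, g n = unitize (u n - \sum_(0 <= i < n) g i *q inner (u n) (g i))) ->
  V 0 -> (forall x y, V x -> V y -> V (x + y)) ->
  (forall (a : R) x, V x -> V (a *: x)) ->
  (forall x y, V x -> V y -> V (y *q inner x y)) ->
  (forall n, V (u n)) -> forall n, V (g n).
Proof.
move=> gE V0 VD VZ VI Vu; elim/ltn_ind => n IH; rewrite gE /unitize; apply: (VZ).
apply: (VD) => //; rewrite -scaleN1r; apply: VZ.
by rewrite big_nat; apply: (big_ind V) => // i /andP[_ /IH hi]; exact: VI.
Qed.

(** * Consequences of separability: bases of closed subspaces and adjoints *)

Section Separable.
Hypothesis Hsep : separable_space H.

Lemma separable_subset V : V !=set0 -> exists2 u : nat -> H,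
  (forall n, V (u n)) & forall x, V x -> forall e : R, 0 < e ->
    exists n, `|x - u n| <= e.
Proof.
move=> [v0 Vv0]; have [S [Sc Sd]] := Hsep.
have [f finj] : exists f : H -> nat, {in S &, injective f}.
  by apply/countable_injP.
pose s n := xget 0 [set x | S x /\ f x = n].
have sP x : S x -> s (f x) = x.
  move=> Sx; rewrite /s; case: xgetP => [y _ [Sy fy]|/(_ x)]; last by case.
  by apply: finj; rewrite ?inE.
(* The dense set may miss [V]; each of its points is replaced by points of [V] within [1/(k+1)] of
   it, when there are any. *)
pose A j k : set H := [set y | V y /\ `|y - s j| <= k.+1%:R^-1].
pose u n := if unpickle n is Some (j, k) then xget v0 (A j k) else v0.
exists u => [n|x Vx e e0].
  rewrite /u; case: unpickle => [[j k]|//].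
  by case: xgetP => [y _ []|].
(* Both [x] and the chosen point of [V] are within [1/(k+1)] of the same dense point, hence the
   factor 2. *)
pose k := Num.trunc (2 / e).
have hk : 2 * (k.+1%:R : R)^-1 <= e.
  rewrite ler_pdivrMr // mulrC -ler_pdivrMr //.
  by apply/ltW; apply: (archimedean.Num.Theory.truncnS_gt (2 / e)).
have k0 : (0 : R) < k.+1%:R^-1 by rewrite invr_gt0.
have [y [By Sy]] : ball x k.+1%:R^-1 `&` S !=set0.
  apply: Sd; last exact: ball_open.
  by exists x; apply: ballxx.
have hy : `|x - s (f y)| <= k.+1%:R^-1.
  by rewrite sP //; move: By; rewrite -ball_normE /= => /ltW.
exists (pickle (f y, k)); rewrite /u pickleK; case: xgetP => [z _ [Vz hz]|/(_ x)].
  rewrite -(subrK (s (f y)) x) -addrA; apply: (le_trans (ler_normD _ _)).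
  apply: le_trans hk; rewrite mulr2n mulrDl !mul1r lerD // distrC //.
by case.
Qed.

Lemma exists_pon V : csub V -> exists g : nat -> H,
  [/\ pon g, forall n, V (g n) & total g V].
Proof.
move=> hV; case: (hV) => V0 VD VS _.
have [u Vu ud] : exists2 u : nat -> H, (forall n, V (u n)) &
    forall x, V x -> forall e : R, 0 < e -> exists n, `|x - u n| <= e.
  by apply: separable_subset; exists 0.
have [g hg gE] := gram_schmidt u; exists g; split=> //.
  apply: (gram_schmidt_mem gE) => // [a x|x y _]; last exact: VS.
  by rewrite -rscale_r; apply: VS.
(* As [x] is orthogonal to [u n], the norm of [x - u n] is at least that of [x], yet it can be made
   arbitrarily small. *)
move=> x Vx /(gram_schmidt_orth gE) hx; apply: near0_eq0 => e e0.
have [n hn] := ud x Vx e e0; apply: le_trans hn; apply: le_norm2 => //.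
by rewrite normB2 /ip hx mulr0 subr0 lerDl sqr_ge0.
Qed.

(** The adjoint at [y] is the series with coefficients [inner y (T (g k))]. Evaluating [T] at a
    partial sum [z] of it gives [ip (T z) y = |z|^2], so [|z|] is at most [M |y|] and the series
    converges. *)
Lemma exists_adj T : bounded_operator T -> exists2 T', bounded_operator T' & adj T T'.
Proof.
move=> hT; have lT := bop_lin hT; have [M M0 hM] := bop_bnd hT.
have [g [hg _ gt]] := exists_pon csubT.
pose c y k := inner y (T (g k)).
have cE y k : inner (g k) (g k) * c y k = c y k.
  by rewrite /c; case: (proj2 hg k) => ->; rewrite ?(lin0 lT) ?inner0r ?mulr0 ?mul1r.
have hc y n : `|psum g (c y) n| <= M * `|y|.
  set z := psum g (c y) n.
  have h : ip (T z) y = `|z| ^+ 2.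
    have zi i : (0 <= i < n)%N -> inner z (g i) = c y i.
      by move=> hi; rewrite pon_inner ?iota_uniq ?mem_index_iota // cE.
    rewrite normE2 /ip.
    have -> : inner z z = inner z (psum g (c y) n) by [].
    rewrite {1}/z /psum (lin_sum lT) inner_suml inner_sumr.
    congr qre; rewrite !big_nat; apply: eq_bigr => i hi.
    by rewrite (linS lT) innerZl innerZr zi // [in LHS]inner_conj.
  have [->|z0] := eqVneq z 0; first by rewrite normr0 mulr_ge0 // ltW.
  have zp : 0 < `|z| by rewrite normr_gt0.
  rewrite -(ler_pM2l zp) -expr2 -h; apply: (le_trans (ip_le _ _)).
  by rewrite mulrA (mulrC _ M) ler_wpM2r.
have Vt : forall k, setT (g k) by [].
have adjT : adj T (fun y => fsum g (c y)).
  move=> x y; apply: (total_sub hg csubT _ gt (csub_inner_eq y _ hT)) => // k /=.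
  by rewrite [in RHS]inner_conj (fsum_inner hg _ (hc y)) cE inner_conj.
exists (fun y => fsum g (c y)) => //.
apply: (@bnd_bop _ _ M) => [x y q|y]; last exact: fsum_norm.
apply/eqP; rewrite -subr_eq0; apply/eqP/inner_eq0.
set d := _ - _; rewrite {2}/d innerBr innerDr innerZr -!adjT.
by rewrite innerDr innerZr subrr.
Qed.

End Separable.
End OrthonormalFamilies.

(** * Square roots, signs and binary expansions *)

Section SpectralTheory.
Variables (R : realType) (H : rightQHilbertType R).
Implicit Types (x y z : H) (S T Q X Z : H -> H) (V : set H).

Lemma comm_adj S Z Z' : adj S S -> adj Z Z' -> comm Z S -> comm Z' S.
Proof.
move=> hS hZ h; apply: (adj_inj (X := fun y => S (Z y))); first exact: adj_comp.
by move=> a b; rewrite -h hZ hS.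
Qed.

Lemma bnd_isometry T : adj T T -> (forall x, T (T x) = x) -> forall x, `|T x| = `|x|.
Proof.
move=> hT h x; apply/eqP; rewrite -(eqrXn2 (n := 2)) // !normE2.
by rewrite (adj_ip hT) h.
Qed.

(** Positivity at [x - r^-1 Q x] gives [|Q x|^2 <= r ip (Q x) x]; completing the square then gives
    the bound. *)
Lemma positive_bnd (r : R) Q : 0 < r -> adj Q Q -> (forall x, 0 <= ip (Q x) x) ->
  lin Q -> bnd r Q -> bnd (r / 2) (fun x => Q x - (r / 2) *: x).
Proof.
move=> r0 aQ pQ lQ bQ x.
have h : `|Q x| ^+ 2 <= r * ip (Q x) x.
  have := pQ (x - r^-1 *: Q x); rewrite (linB lQ) (linZ lQ) ipBl !ipBr !ipZl !ipZr.
  rewrite (adj_ip aQ (Q x) x) -normE2 => h.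
  have h2 : ip (Q (Q x)) (Q x) <= r * `|Q x| ^+ 2.
    apply: (le_trans (ip_le _ _)); rewrite expr2 mulrA.
    by apply: ler_wpM2r.
  have h3 : r^-1 * ip (Q (Q x)) (Q x) <= `|Q x| ^+ 2 by rewrite ler_pdivrMl.
  have h4 : 0 <= r * (ip (Q x) x - r^-1 * `|Q x| ^+ 2).
    rewrite pmulr_rge0 //; apply: (le_trans h).
    have := ler_wpM2l (ltW (_ : 0 < r^-1)) h3; rewrite invr_gt0 => /(_ r0); lra.
  by move: h4; rewrite mulrBr mulrA mulfV ?gt_eqF // mul1r subr_ge0.
apply: le_norm2; first by rewrite mulr_ge0 // divr_ge0 // ltW.
rewrite normB2 normZ2 ipZr exprMn.
by move: h; lra.
Qed.

(** * Strong limits of uniformly bounded operators *)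

Section Limit.
Variables (Y : nat -> H -> H) (M : R).
Hypotheses (Ylin : forall n, lin (Y n)) (Ybnd : forall n, bnd M (Y n)).
Hypothesis Ycvg : forall x, cvgn (fun n => Y n x).

Let L x := limn (fun n => Y n x).

Let LE x : (fun n => Y n x) @ \oo --> L x.
Proof. exact: Ycvg. Qed.
Arguments LE x : clear implicits.

Lemma lim_bop : bounded_operator L /\ bnd M L.
Proof.
have Lb : bnd M L by move=> x; apply: (cvg_norm_le (LE x)) => n; apply: Ybnd.
split=> //; apply: bnd_bop Lb => x y q; apply: (cvg_eq (LE _)).
rewrite (_ : (fun n => _) = fun n => Y n x *q q + Y n y); last first.
  by apply/funext => n; rewrite Ylin.
by apply: cvgD (LE y); apply: cvg_rscale; apply: LE.
Qed.

Lemma lim_adj : (forall n, adj (Y n) (Y n)) -> adj L L.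
Proof.
move=> h x y; apply: inner_eqP => q.
have h1 := cvg_ip (x := y) (cvg_rscale (q := q) (LE x)).
have h2 := cvg_ip (x := x *q q) (LE y).
rewrite -(cvg_lim (@norm_hausdorff _ _) h1) [RHS]ipC.
rewrite -(cvg_lim (@norm_hausdorff _ _) h2); congr (limn _); apply/funext => n.
by rewrite -(linS (Ylin n)) (adj_ip (h n)) ipC.
Qed.

Lemma lim_comm Z : bounded_operator Z -> (forall n, comm Z (Y n)) -> comm Z L.
Proof.
move=> hZ h x; apply: (cvg_eq (cvg_bop hZ (LE x))).
rewrite (_ : (fun n => _) = fun n => Y n (Z x)); first exact: LE.
by apply/funext => n; apply: h.
Qed.

(** The uniform bound [M] is what makes [Y n (Y n x - L x)] tend to 0. *)
Lemma lim_sqr x : (fun n => Y n (Y n x)) @ \oo --> L (L x).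
Proof.
rewrite (_ : (fun n => _) = fun n => Y n (Y n x - L x) + Y n (L x)); last first.
  by apply/funext => n; rewrite (linB (Ylin n)) subrK.
rewrite -[L (L x)]add0r; apply: cvgD (LE _).
have /cvgrPdist_le h := LE x; apply/cvgrPdist_le => e e0.
have c0 : 0 < `|M| + 1 by rewrite ltr_wpDl.
have /h : 0 < e / (`|M| + 1) by rewrite divr_gt0.
apply: filterS => n hn; rewrite sub0r normrN; apply: (le_trans (Ybnd _ _)).
apply: (@le_trans _ _ ((`|M| + 1) * `|L x - Y n x|)).
  rewrite distrC; apply: ler_wpM2r => //.
  by apply: (le_trans (ler_norm M)); rewrite lerDl.
by rewrite mulrC -ler_pdivlMr.
Qed.

End Limit.

(** * The positive square root *)

Section SquareRoot.
Variables (C : H -> H).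
Hypotheses (Cbop : bounded_operator C) (Cadj : adj C C).
Hypothesis Cbnd : bnd 1 (fun x => x - C x).

(* [sqrt_op] converges to [1 - sqrt C]; its increments are dominated by those of
   the scalar sequence [sqrt_maj], the case [C = 0]. *)
Fixpoint sqrt_op n : H -> H := if n is n'.+1 then
  fun x => 2^-1 *: ((x - C x) + sqrt_op n' (sqrt_op n' x)) else fun=> 0.

Fixpoint sqrt_maj n : R := if n is n'.+1 then
  2^-1 * (1 + sqrt_maj n' ^+ 2) else 0.

Lemma sqrt_maj_bound n : 0 <= sqrt_maj n <= 1.
Proof.
elim: n => [|n /andP[h0 h1]] /=; first by rewrite lexx ler01.
have : sqrt_maj n ^+ 2 <= 1 by rewrite exprn_ile1.
have := sqr_ge0 (sqrt_maj n).
by move=> *; apply/andP; split; lra.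
Qed.

Lemma sqrt_maj_le n : sqrt_maj n <= sqrt_maj n.+1.
Proof.
have := sqr_ge0 (1 - sqrt_maj n); rewrite /= => h.
by rewrite -subr_ge0; move: h; rewrite sqrrB; lra.
Qed.

Lemma sqrt_op_bop n : bounded_operator (sqrt_op n).
Proof.
elim: n => [|n IH] /=.
  by apply: (@bnd_bop _ _ 0) => [x y q|x]; rewrite ?rscale0l ?addr0 // normr0 mul0r.
apply: bop_scale; apply: bop_add (bop_comp IH IH).
by apply: bop_sub Cbop; apply: bop_id.
Qed.

Lemma sqrt_op_adj n : adj (sqrt_op n) (sqrt_op n).
Proof.
elim: n => [|n IH] /=; first by move=> x y; rewrite inner0l inner0r.
apply: adj_scale; apply: adj_add (adj_comp IH IH).
by apply: adj_sub Cadj; apply: adj_id.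
Qed.

Lemma sqrt_op_comm n Z : bounded_operator Z -> comm Z C -> comm Z (sqrt_op n).
Proof.
move=> /bop_lin lZ hZ; elim: n => [|n IH] x /=; first exact: lin0.
by rewrite (linZ lZ) (linD lZ) (linB lZ) hZ !IH.
Qed.

Lemma sqrt_op_bnd n : bnd (sqrt_maj n) (sqrt_op n).
Proof.
elim: n => [|n IH] x /=; first by rewrite normr0 mul0r.
rewrite normrZ ger0_norm ?invr_ge0 // -mulrA ler_pM2l ?invr_gt0 //.
apply: (le_trans (ler_normD _ _)); rewrite mulrDl; apply: lerD; first exact: Cbnd.
apply: (le_trans (IH _)); rewrite expr2 -mulrA ler_wpM2l //.
by case/andP: (sqrt_maj_bound n).
Qed.

(** For Y the new and Z the old iterate, [Y Y - Z Z = Y (Y - Z) + (Y - Z) Z]; the increments of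
    [sqrt_maj] factor in the same way, so the bounds match term by term. *)
Lemma sqrt_op_step n x :
  `|sqrt_op n.+1 x - sqrt_op n x| <= (sqrt_maj n.+1 - sqrt_maj n) * `|x|.
Proof.
elim: n x => [|n IH] x.
  rewrite /= !subr0 addr0 expr0n addr0 mulr1 normrZ ger0_norm ?invr_ge0 //.
  by rewrite ler_pM2l ?invr_gt0 // -[leRHS]mul1r; apply: Cbnd.
set d := sqrt_maj n.+1 - sqrt_maj n in IH *.
have dE : sqrt_maj n.+2 - sqrt_maj n.+1 =
    2^-1 * (sqrt_maj n.+1 * d + d * sqrt_maj n).
  by rewrite {1}[sqrt_maj n.+2]/= {1 2}[sqrt_maj n.+1]/= /d /=; lra.
have d0 : 0 <= d by rewrite subr_ge0 sqrt_maj_le.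
have -> : sqrt_op n.+2 x - sqrt_op n.+1 x =
    2^-1 *: (sqrt_op n.+1 (sqrt_op n.+1 x - sqrt_op n x) +
             (sqrt_op n.+1 (sqrt_op n x) - sqrt_op n (sqrt_op n x))).
  rewrite (linB (bop_lin (sqrt_op_bop n.+1))) addrA subrK.
  rewrite [sqrt_op n.+2 x]/= -/(sqrt_op n.+1 x) {5}[sqrt_op n.+1]/=.
  by rewrite -scalerBr opprD addrACA subrr add0r.
rewrite dE normrZ ger0_norm ?invr_ge0 // -mulrA ler_pM2l ?invr_gt0 //.
apply: (le_trans (ler_normD _ _)); rewrite mulrDl; apply: lerD.
  apply: (le_trans (sqrt_op_bnd _ _)); rewrite -mulrA ler_wpM2l //.
  by case/andP: (sqrt_maj_bound n.+1).
apply: (le_trans (IH _)); rewrite -mulrA ler_wpM2l //.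
exact: sqrt_op_bnd.
Qed.

Lemma sqrt_op_cauchy m n x : (n <= m)%N ->
  `|sqrt_op m x - sqrt_op n x| <= (sqrt_maj m - sqrt_maj n) * `|x|.
Proof.
elim: m => [|m IH]; first by rewrite leqn0 => /eqP->; rewrite !subrr normr0 mul0r.
rewrite leq_eqVlt => /orP[/eqP->|]; first by rewrite !subrr normr0 mul0r.
rewrite ltnS => /IH h; rewrite -(subrK (sqrt_op m x) (sqrt_op m.+1 x)) -addrA.
apply: (le_trans (ler_normD _ _)).
have := sqrt_op_step m x; move: h; lra.
Qed.

(** The limit L of the iteration satisfies [2 L = (1 - C) + L^2], that is [(1 - L)^2 = C]; and
    [1 - L] is positive because L is a contraction. *)
Lemma exists_sqrt : exists Q, [/\ bounded_operator Q, adj Q Q,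
  forall x, Q (Q x) = C x, forall x, 0 <= ip (Q x) x &
  forall Z, bounded_operator Z -> comm Z C -> comm Z Q].
Proof.
pose L x := limn (fun n => sqrt_op n x).
have Ylin n : lin (sqrt_op n) by apply/bop_lin/sqrt_op_bop.
have Ybnd n : bnd 1 (sqrt_op n).
  move=> x; apply: (le_trans (sqrt_op_bnd n x)); apply: ler_wpM2r => //.
  by case/andP: (sqrt_maj_bound n).
have Ycvg x : cvgn (fun n => sqrt_op n x).
  (* [sqrt_maj] takes its values in [0, 1], so the square of an increment is at most the increment,
     as [cvg_majorant] requires. *)
  apply: (@cvg_majorant _ _ _ (fun n => sqrt_maj n * `|x| ^+ 2) (`|x| ^+ 2)).
    move=> m n nm; have h := sqrt_op_cauchy x nm.
    have /andP[h1 h2] := sqrt_maj_bound m; have /andP[h3 h4] := sqrt_maj_bound n.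
    have dp : 0 <= sqrt_maj m - sqrt_maj n.
      by rewrite subr_ge0; apply: (homo_leq (@lexx _ R) (@le_trans _ R) sqrt_maj_le nm).
    rewrite -mulrBl; apply: (@le_trans _ _ (((sqrt_maj m - sqrt_maj n) * `|x|) ^+ 2)).
      by rewrite ler_sqr ?nnegrE // mulr_ge0.
    rewrite exprMn ler_wpM2r ?sqr_ge0 // expr2 -[leRHS]mulr1 ler_wpM2l //.
    by move: h1 h2 h3 h4; lra.
  by move=> n; rewrite -[leRHS]mul1r ler_wpM2r ?sqr_ge0 //; case/andP: (sqrt_maj_bound n).
have [Lbop Lbnd] := lim_bop Ylin Ybnd Ycvg.
have Ladj : adj L L := lim_adj Ylin Ycvg sqrt_op_adj.
have lL := bop_lin Lbop; rewrite -/L in Lbop Lbnd lL.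
have LE x : L x + L x = (x - C x) + L (L x).
  have h1 := lim_sqr Ylin Ybnd Ycvg (x := x).
  have h2 : (fun n => sqrt_op n.+1 x + sqrt_op n.+1 x) @ \oo --> L x + L x.
    have h3 : (fun n => sqrt_op n.+1 x) @ \oo --> L x.
      by rewrite (cvg_shiftS (fun n => sqrt_op n x)); apply: Ycvg.
    exact: cvgD.
  apply: (cvg_eq h2).
  rewrite (_ : (fun n => _) = fun n => (x - C x) + sqrt_op n (sqrt_op n x)).
    by apply: cvgD h1; apply: cvg_cst.
  apply/funext => n /=; rewrite -scalerDl -[RHS]scale1r; congr (_ *: _); lra.
exists (fun x => x - L x); split.
- by apply: bop_sub Lbop; apply: bop_id.
- by apply: adj_sub Ladj; apply: adj_id.
- move=> x; have e : L (L x) = L x + L x - (x - C x) by rewrite LE addrAC subrr add0r.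
  rewrite (linB lL) e opprB.
  have -> : L x + L x - (x - C x) - L x = L x - (x - C x) by rewrite addrAC addrK.
  by rewrite addrA subrK opprB addrC subrK.
- move=> x; rewrite ipBl subr_ge0 -normE2 expr2; apply: (le_trans (ip_le _ _)).
  by rewrite ler_wpM2r // -[leRHS]mul1r; apply: Lbnd.
move=> Z hZ cZ x; have lZ := bop_lin hZ.
rewrite (linB lZ) -/(L _); congr (_ - _).
by apply: (lim_comm Ycvg hZ) => n; apply: sqrt_op_comm.
Qed.

End SquareRoot.

(** Division by [r^2] puts [X' X] within reach of [exists_sqrt]: the resulting C satisfies
    [|x - C x|^2 <= |x|^2 - r^-2 |X x|^2]. *)
Lemma exists_abs (r : R) X X' : 0 < r -> bounded_operator X -> bounded_operator X' ->
  adj X X' -> bnd r X -> bnd r X' ->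
  exists Q, [/\ bounded_operator Q, adj Q Q, forall x, Q (Q x) = X' (X x),
    forall x, 0 <= ip (Q x) x &
    forall Z, bounded_operator Z -> comm Z (fun x => X' (X x)) -> comm Z Q].
Proof.
move=> r0 hX hX' aX bX bX'.
have rn0 : r != 0 by rewrite gt_eqF.
pose C x := r^-2 *: X' (X x).
have Cbop : bounded_operator C by apply: bop_scale; apply: bop_comp.
have Cadj : adj C C by apply: adj_scale; apply: adj_comp => //; apply: adj_sym.
have Cbnd : bnd 1 (fun x => x - C x).
  move=> x; rewrite mul1r; apply: le_norm2 => //.
  rewrite normB2 normZ2 ipZr -(adj_ip aX) -normE2.
  have : `|X' (X x)| ^+ 2 <= r ^+ 2 * `|X x| ^+ 2.
    by rewrite -exprMn ler_sqr ?nnegrE // mulr_ge0 // ltW.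
  have r2 : 0 < r ^- 2 by rewrite invr_gt0 exprn_gt0.
  move=> /(ler_wpM2l (ltW (mulr_gt0 r2 r2))).
  rewrite [leRHS]mulrA -(mulrA (r ^- 2) (r ^- 2) (r ^+ 2)) mulVf ?expf_neq0 // mulr1.
  by rewrite -expr2; have := mulr_ge0 (ltW r2) (sqr_ge0 `|X x|); lra.
have [Q [Qbop Qadj QE Qpos Qcomm]] := exists_sqrt Cbop Cadj Cbnd.
have lQ := bop_lin Qbop; exists (fun x => r *: Q x); split.
- exact: bop_scale.
- exact: adj_scale.
- move=> x; rewrite (linZ lQ) QE /C !scalerA -expr2 divff ?scale1r //.
  by rewrite expf_neq0.
- by move=> x; rewrite ipZl mulr_ge0 // ltW.
move=> Z hZ cZ x; have lZ := bop_lin hZ; rewrite (linZ lZ) Qcomm // => y.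
by rewrite /C (linZ lZ) cZ.
Qed.

(** * Projections, signs and binary expansions *)

Section Separable.
Hypothesis Hsep : separable_space H.

Lemma exists_proj V : csub V -> exists P, [/\ bounded_operator P, adj P P,
  forall x, V (P x), forall x v, V v -> inner (x - P x) v = 0 &
  forall Z Z', adj Z Z' -> lin Z -> (forall x, V x -> V (Z x)) ->
    (forall x, V x -> V (Z' x)) -> comm Z P].
Proof.
move=> hV; have [g [hg Vg gt]] := exists_pon Hsep hV.
have VP x : V (proj g x) by apply: proj_csub.
have orth x v : V v -> inner (x - proj g x) v = 0.
  move=> Vv; apply: inner_eq0C; rewrite -(total_proj hg hV Vg gt Vv).
  have h := @proj_cvg _ _ _ hg v.
  apply: inner_eq0P => q; apply: (cvg_ip_eq0 (cvg_rscale (q := q) h)) => n.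
  rewrite /ip innerZl /psum inner_suml big1 ?mul0r // => i _.
  by rewrite innerZl [inner (g i) _]inner_eq0C ?mul0r // proj_orth.
(* This characterization of the projection yields both its linearity and its commutation with
   operators that reduce [V]. *)
have uniq x y : V y -> (forall v, V v -> inner (x - y) v = 0) -> y = proj g x.
  move=> Vy h; apply/eqP; rewrite -subr_eq0; apply/eqP/inner_eq0.
  have Vd : V (y - proj g x) by apply: csubB.
  set d := y - proj g x in Vd *.
  have {1}-> : d = (x - proj g x) - (x - y) by rewrite opprB addrC addrA subrK.
  by rewrite innerBl orth // h // subrr.
have lP : lin (proj g).
  move=> x y q; apply/esym/uniq.
    by case: (hV) => _ VD VS _; apply: VD => //; apply: VS.
  move=> v Vv; rewrite opprD addrACA -rscaleBl innerDl innerZl.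
  by rewrite !orth // mul0r addr0.
have bP : bnd 1 (proj g) by move=> x; rewrite mul1r proj_norm.
exists (proj g); split=> //; first exact: bnd_bop bP.
  move=> x y; transitivity (inner (proj g x) (proj g y)).
    rewrite -{1}(subrK (proj g y) y) innerDr.
    by rewrite [inner _ (y - _)]inner_eq0C ?add0r // orth.
  by rewrite -{2}(subrK (proj g x) x) innerDl orth // add0r.
move=> Z Z' aZ lZ VZ VZ' x; apply: uniq; first exact: VZ.
by move=> v Vv; rewrite -(linB lZ) aZ orth //; apply: VZ'.
Qed.

Definition involution T := [/\ bounded_operator T, adj T T & forall x, T (T x) = x].

(** With [Q = |S|] and [P] the projection onto the kernel of [Q - S], the sign is [2 P - 1]; it is 1
    on the kernel of [S]. Being an isometry with [S sg = Q], it turns [S - (r/2) sg] into [Q - r/2],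
    which [positive_bnd] estimates. An operator commuting with [S] commutes with [Q], and so does
    its adjoint, so both preserve the kernel. *)
Lemma exists_sign S (r : R) : 0 < r -> bounded_operator S -> adj S S -> bnd r S ->
  exists2 sg, involution sg & bnd (r / 2) (fun x => S x - (r / 2) *: sg x) /\
  forall Z Z', bounded_operator Z -> adj Z Z' -> comm Z S -> comm Z sg.
Proof.
move=> r0 hS aS bS; have lS := bop_lin hS.
have [Q [hQ aQ QE pQ cQ]] := exists_abs r0 hS hS aS bS bS.
have lQ := bop_lin hQ.
have cSQ : comm S Q by apply: cQ => // x.
have bQ : bnd r Q.
  move=> x; apply: (le_trans _ (bS x)); apply: le_norm2 => //.
  by rewrite !normE2 (adj_ip aQ) QE -(adj_ip aS).
pose V := [set x | Q x = S x].
have hV : csub V by apply: csub_eq.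
have VS x : V x -> V (S x) by rewrite /V /= -cSQ => ->.
have [P [hP aP VP orth cP]] := exists_proj hV; have lP := bop_lin hP.
have VPid v : V v -> P v = v.
  move=> Vv; apply/esym/eqP; rewrite -subr_eq0; apply/eqP/inner_eq0.
  by apply: orth; apply: csubB.
pose sg x := P x - (x - P x).
have Qsg x : Q x = S (sg x).
  rewrite /sg; set o := x - P x; have -> : x = P x + o by rewrite addrC subrK.
  (* For [o] orthogonal to [V], the vector [S o + Q o] lies in [V] because [Q^2 = S^2] and [S]
     commutes with [Q]; it is also orthogonal to [V], since [S + Q] is self-adjoint and preserves
     [V]. *)
  have w0 : S o + Q o = 0.
    have Vw : V (S o + Q o).
      by rewrite /V /= (linD lQ) (linD lS) -cSQ QE addrC.
    apply: inner_eq0; move: Vw; set w := S o + Q o => Vw.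
    rewrite {1}/w innerDl aS aQ (Vw : Q w = S w) orth ?addr0 //; exact: VS.
  have -> : P (P x + o) = P x by rewrite /o addrC subrK.
  rewrite (linD lQ) (VP x : Q (P x) = S (P x)) (linB lS).
  by congr (_ + _); apply/eqP; rewrite -addr_eq0 addrC w0.
have hsg : bounded_operator sg by do !apply: bop_sub => //; apply: bop_id.
have asg : adj sg sg by do !apply: adj_sub => //; apply: adj_id.
have lsg := bop_lin hsg.
have sgK x : sg (sg x) = x.
  have e : P (sg x) = P x by rewrite /sg !(linB lP) (VPid (P x)) // subrr subr0.
  by rewrite {1}/sg e /sg addrAC subrr sub0r opprK addrC subrK.
have csg Z Z' : bounded_operator Z -> adj Z Z' -> comm Z S -> comm Z sg.
  move=> hZ aZ cZ; have lZ := bop_lin hZ.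
  have cZ' := comm_adj aS aZ cZ.
  have cZC : comm Z (fun x => S (S x)) by move=> y; rewrite !cZ.
  have cZQ := cQ _ hZ cZC.
  have cZQ' := comm_adj aQ aZ cZQ.
  have cZP : comm Z P.
    apply: (cP _ Z') => // x; rewrite /V /=; first by rewrite -cZQ -cZ => ->.
    by rewrite -cZQ' -cZ' => ->.
  by move=> x; rewrite /sg !(linB lZ) !cZP.
exists sg; first by split.
split=> // x; have nsg := bnd_isometry asg sgK.
have cSsg : comm S sg by apply: csg aS _.
rewrite -(nsg (S x - _)) (linB lsg) (linZ lsg) sgK -cSsg -Qsg.
exact: positive_bnd.
Qed.

Lemma exists_expansion S (r : R) : 0 < r -> bounded_operator S -> adj S S -> bnd r S ->
  exists sg : nat -> H -> H, [/\ forall k, involution (sg k),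
    forall n, bnd (r / 2 ^+ n)
      (fun x => S x - \sum_(i < n) (r / 2 ^+ i.+1) *: sg i x) &
    forall k Z Z', bounded_operator Z -> adj Z Z' -> comm Z S -> comm Z (sg k)].
Proof.
move=> r0 hS aS bS.
pose good (p : R * (H -> H)) :=
  [/\ 0 < p.1, bounded_operator p.2, adj p.2 p.2 & bnd p.1 p.2].
pose spec (p : R * (H -> H)) sg := [/\ involution sg,
  bnd (p.1 / 2) (fun x => p.2 x - (p.1 / 2) *: sg x) &
  forall Z Z', bounded_operator Z -> adj Z Z' -> comm Z p.2 -> comm Z sg].
have [F FP] : {F : R * (H -> H) -> H -> H & forall p, good p -> spec p (F p)}.
  apply: (choice (P := fun p sg => good p -> spec p sg)) => p.
  have [[h1 h2 h3 h4]|ng] := pselect (good p); last by exists idfun.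
  by have [sg ? [? ?]] := exists_sign h1 h2 h3 h4; exists sg.
(* [st n] is the remainder after [n] digits, bounded by [r / 2 ^+ n]; the next digit is its sign. *)
pose st := fix st n := if n is n'.+1 then
  fun x => st n' x - (r / 2 ^+ n'.+1) *: F (r / 2 ^+ n', st n') x else S.
have rS n : r / 2 ^+ n / 2 = r / 2 ^+ n.+1 by rewrite exprSr invfM mulrA.
have gst n : good (r / 2 ^+ n, st n) /\
    forall Z Z', bounded_operator Z -> adj Z Z' -> comm Z S -> comm Z (st n).
  elim: n => [|n [IH IHc]]; first by split=> //; split; rewrite //= expr0 divr1.
  have [[h1 h2 h3] b c] := FP _ IH; case: IH => r1 hs as_ bs; split.
    split=> /=.
    - by rewrite divr_gt0 // exprn_gt0.
    - by apply: bop_sub => //; apply: bop_scale.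
    - by apply: adj_sub => //; apply: adj_scale.
    by move: b; rewrite /= rS.
  move=> Z Z' hZ aZ cZ x /=; have lZ := bop_lin hZ.
  rewrite (linB lZ) (linZ lZ) (IHc _ _ hZ aZ cZ).
  by rewrite (c _ _ hZ aZ (IHc _ _ hZ aZ cZ)).
have stE n x : st n x = S x - \sum_(i < n) (r / 2 ^+ i.+1) *: F (r / 2 ^+ i, st i) x.
  elim: n => [|n IH] /=; first by rewrite big_ord0 subr0.
  by rewrite IH big_ord_recr /= opprD addrA.
exists (fun k => F (r / 2 ^+ k, st k)); split=> [k|n x|k Z Z' hZ aZ cZ].
- by case: (FP _ (gst k).1).
- by rewrite -stE; have [[_ _ _ b] _] := gst n; exact: (b x).
by case: (FP _ (gst k).1) => _ _; apply; [exact: hZ|exact: aZ|exact: (gst k).2 cZ].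
Qed.

End Separable.
End SpectralTheory.

(** * Bases adapted to an anti-self-adjoint operator *)

Section AdaptedBasis.
Variables (R : realType) (H : rightQHilbertType R).
Implicit Types (x y z : H) (V : set H).
Variables (B Q : H -> H).
Hypotheses (Bbop : bounded_operator B) (Qbop : bounded_operator Q).
Hypotheses (Badj : adj B (fun x => - B x)) (Qadj : adj Q Q).
Hypotheses (QB : comm Q B) (QQ : forall x, Q (Q x) = - B (B x)).

Let lB := bop_lin Bbop.
Let lQ := bop_lin Qbop.

(** Since [j] anticommutes with [i], right multiplication by [j] reverses the sign in this equation:
    adapted vectors form a complex subspace, not a quaternionic one. *)
Definition adapted x := B x = Q x *q qi.

(* [2 Q] times the projection onto the adapted vectors, when [B = J Q] with [J] a
   complex structure. *)
Definition adapt y := Q y - B y *q qi.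

Lemma norm_QB x : `|Q x| = `|B x|.
Proof.
apply/eqP; rewrite -(eqrXn2 (n := 2)) // !normE2 (adj_ip Qadj) QQ (adj_ip Badj).
by rewrite ipNr.
Qed.

Lemma adapt_adapted y : adapted (adapt y).
Proof.
rewrite /adapted /adapt (linB lB) (linB lQ) (linS lB) (linS lQ) QB QQ.
by rewrite rscaleBl rscaleA qii rscale_r scaleN1r opprK rscaleNl addrC.
Qed.

(** The inner product has no j and k parts, which keeps Gram-Schmidt inside the range of [adapt]. *)
Lemma adapt_inner y x : adapted x ->
  inner (adapt y) x = qc (2 * qre (inner (Q y) x)) (2 * qim (inner (Q y) x)).
Proof.
move=> hx; rewrite /adapt innerBl innerZl Badj hx innerNr innerZr -(Qadj y).
by case: (inner (Q y) x) => a b c d; apply: quatP => /=; ring.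
Qed.

Lemma adapt_qc y (a b : R) : adapt y *q qc a b = adapt (y *q qc a b).
Proof.
rewrite /adapt rscaleBl (linS lQ) (linS lB) !rscaleA; congr (_ - _ *q _).
by apply: quatP => /=; ring.
Qed.

(** The range of [adapt] and its right multiple by [j] together recover the range of [Q], so a
    vector orthogonal to the former is orthogonal to the latter. *)
Lemma adapt_qj y : adapt y - adapt (y *q qjj) *q qjj = Q y + Q y.
Proof.
rewrite /adapt (linS lQ) (linS lB) rscaleBl !rscaleA.
have -> : qjj * qjj = - 1 :> quat R by apply: quatP => /=; ring.
have -> : qjj * (qi * qjj) = qi :> quat R by apply: quatP => /=; ring.
by rewrite rscaleN rscale1 opprB opprK addrA subrK.
Qed.

Hypothesis Hsep : separable_space H.

Lemma dense_orth V (u : nat -> H) x :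
  (forall z, V z -> forall e : R, 0 < e -> exists n, `|z - u n| <= e) ->
  (forall n, inner x (u n) = 0) -> forall z, V z -> inner x z = 0.
Proof.
move=> ud hu z Vz; apply: inner_eq0P => q.
apply/eqP; rewrite -normr_le0; apply/ler_addgt0Pl => e e0; rewrite addr0.
have c0 : 0 < `|x *q q| + 1 by rewrite ltr_wpDl.
have [n hn] := ud z Vz _ (divr_gt0 e0 c0).
have -> : ip (x *q q) z = ip (x *q q) (z - u n).
  by rewrite ipBr [X in _ - X](_ : _ = 0) ?subr0 // /ip innerZl hu mul0r.
apply: (le_trans (ip_abs _ _)).
rewrite ler_pdivlMr // in hn; apply: le_trans hn; rewrite mulrC.
by rewrite ler_wpM2l // lerDl.
Qed.

(** Codes that represent no index receive the zero vector, which [pon] admits. *)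
Definition pad_nat (I : countType) (g : I -> H) n : H := oapp g 0 (pickle_inv n).

Lemma pon_pad (I : countType) (g : I -> H) : pon g -> pon (pad_nat g).
Proof.
rewrite /pad_nat => hg; split=> [m n mn|n]; last first.
  by case: pickle_inv => [i|] /=; [apply: (proj2 hg)|left].
have := @pickle_invK I m; have := @pickle_invK I n.
case: (pickle_inv m) (pickle_inv n) => [i|] [j|] /=; rewrite ?inner0l ?inner0r //.
by move=> e1 e2; apply: (proj1 hg); apply: contraNneq mn => e; rewrite -e1 -e2 e.
Qed.

Lemma pad_mem (I : countType) (g : I -> H) V : V 0 -> (forall i, V (g i)) ->
  forall n, V (pad_nat g n).
Proof. by move=> V0 h n; rewrite /pad_nat; case: pickle_inv => /=. Qed.

Lemma total_pad (I : countType) (g : I -> H) V : total g V -> total (pad_nat g) V.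
Proof.
by move=> h x Vx hx; apply: h => // i; rewrite -[RHS](hx (pickle i)) /pad_nat pickleK_inv.
Qed.

(** Gram-Schmidt in the range of [adapt] exhausts the part of [V] orthogonal to the kernel of [B].
    On that kernel [Q] vanishes too, so every vector is adapted and any basis will do. *)
Lemma adapted_basis V : csub V -> (forall x, V x -> V (B x)) ->
  (forall x, V x -> V (Q x)) ->
  exists g : nat -> H, [/\ pon g, forall i, V (g i),
    forall i, adapted (g i) & total g V].
Proof.
move=> hV VB VQ; case: (hV) => V0 VD VS _.
pose N := [set adapt y | y in V].
have NV z : N z -> V z.
  by move=> [y Vy <-]; apply: csubB => //; [exact: VQ|apply: VS; exact: VB].
have N_adapted z : N z -> adapted z by move=> [y _ <-]; apply: adapt_adapted.
have [u Nu ud] : exists2 u : nat -> H, (forall n, N (u n)) &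
    forall x, N x -> forall e : R, 0 < e -> exists n, `|x - u n| <= e.
  by apply: separable_subset => //; exists (adapt 0); exists 0.
have [g1 hg1 g1E] := gram_schmidt u.
have Nqc z (a b : R) : N z -> N (z *q qc a b).
  by move=> [y Vy <-]; exists (y *q qc a b); [exact: VS|rewrite adapt_qc].
have Ng1 : forall n, N (g1 n).
  apply: (gram_schmidt_mem g1E) => //.
  - by exists 0; rewrite // /adapt (lin0 lQ) (lin0 lB) rscale0l subr0.
  - move=> _ _ [y Vy <-] [z Vz <-]; exists (y + z); first exact: VD.
    by rewrite /adapt (linD lQ) (linD lB) rscaleDl opprD addrACA.
  - by move=> a z /(Nqc _ a 0); rewrite -/(qr a) rscale_r.
  by move=> _ z [y Vy <-] Nz; rewrite adapt_inner; [exact: Nqc|exact: N_adapted].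
pose K := V `&` [set x | B x = 0].
have hK : csub K.
  apply: csubI => //; apply: (csub_eq Bbop (T := fun=> 0)).
  by apply: (@bnd_bop _ _ 0) => [x y q|x]; rewrite ?rscale0l ?addr0 // normr0 mul0r.
have [g2 [hg2 Kg2 g2t]] := exists_pon Hsep hK.
have KQ x : B x = 0 -> Q x = 0.
  by move=> h; apply: normr0_eq0; rewrite norm_QB h normr0.
have NK z x : N z -> B x = 0 -> inner z x = 0.
  move=> [y Vy <-] Bx; rewrite /adapt innerBl innerZl Badj Qadj Bx KQ //.
  by rewrite oppr0 !inner0r mul0r subr0.
pose g i := match i with inl k => g1 k | inr k => g2 k end.
have adapted0 : adapted 0 by rewrite /adapted (lin0 lB) (lin0 lQ) rscale0l.
suff [h1 h2 h3 h4] : [/\ pon g, forall i, V (g i), forall i, adapted (g i) & total g V].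
  exists (pad_nat g); split; [exact: pon_pad|exact: pad_mem h2|
    exact: pad_mem h3|exact: total_pad].
split.
- split=> [[i|i] [j|j] ij|[i|i]] /=; try by [apply: (proj2 hg1)|apply: (proj2 hg2)].
  + by apply: (proj1 hg1).
  + by apply: NK => //; case: (Kg2 j).
  + by apply/inner_eq0C/NK => //; case: (Kg2 i).
  by apply: (proj1 hg2).
- by move=> [i|i] /=; [exact: NV|case: (Kg2 i)].
- move=> [i|i] /=; first exact: N_adapted.
  by case: (Kg2 i) => _ /= h; rewrite /adapted h KQ // rscale0l.
move=> x Vx hx; have hx1 : forall n, inner x (u n) = 0.
  by apply: (gram_schmidt_orth g1E) => n; apply: (hx (inl n)).
have hN := dense_orth ud hx1.
(* [adapt_qj] at [Q x], paired with [x], gives that twice the square of [|Q x|] is 0. *)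
have Qx : Q x = 0.
  apply: inner_eq0; have Vy := VQ _ Vx.
  have h1 : inner x (adapt (Q x)) = 0 by apply: hN; exists (Q x).
  have h2 : inner x (adapt (Q x *q qjj)) = 0.
    by apply: hN; exists (Q x *q qjj) => //; apply: VS.
  have := adapt_qj (Q x) => /(congr1 (inner x)).
  rewrite innerBr innerZr h1 h2 mulr0 subr0 innerDr -Qadj.
  by case: (inner (Q x) (Q x)) => a b c d [] *; apply: quatP => /=; lra.
apply: g2t => [|i]; last exact: (hx (inr i)).
by split=> //=; apply: normr0_eq0; rewrite -norm_QB Qx normr0.
Qed.

End AdaptedBasis.

(** * The tree of joint eigenspaces *)

Section Cardinality.
Variables (R : realType) (H : rightQHilbertType R).
Implicit Types (V : set H).

Lemma pon_finite_expand (I : eqType) (a : I -> H) V (r : seq I) x :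
  pon a -> csub V -> (forall i, V (a i)) -> total a V -> uniq r ->
  (forall i, a i <> 0 -> i \in r) -> V x ->
  x = \sum_(i <- r) a i *q inner x (a i).
Proof.
move=> ha hV Va ta ur hr Vx; apply/eqP; rewrite -subr_eq0; apply/eqP/ta.
  apply: csubB => //; apply: csub_sum => // i _.
  by case: hV => _ _ VS _; apply: VS.
move=> i; have [ai0|ai0] := eqVneq (a i) 0; first by rewrite ai0 inner0r.
by rewrite pon_orth_out //; apply: hr; apply/eqP.
Qed.

(* Count the sum of the |<b_j, a_i>|^2 in two ways: Parseval for [a], Bessel for
   [b]. *)
Lemma pon_size_le (I J : eqType) (a : I -> H) (b : J -> H) V r t :
  pon a -> pon b -> csub V -> (forall i, V (a i)) -> total a V ->
  (forall j, V (b j)) -> uniq r -> (forall i, a i <> 0 -> i \in r) ->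
  uniq t -> (forall j, j \in t -> b j <> 0) -> (size t <= size r)%N.
Proof.
move=> ha hb hV Va ta Vb ur hr ut ht.
rewrite -(ler_nat R) -!sum1_size !natr_sum.
apply: (@le_trans _ _ (\sum_(j <- t) \sum_(i <- r)
    `|a i| ^+ 2 * qn (inner (b j) (a i)))).
  rewrite [leLHS]big_seq [leRHS]big_seq; apply: ler_sum => j jt.
  rewrite -(pon_norm ha) // -(pon_finite_expand ha hV) //.
  by rewrite normE2 /ip (pon_unit hb) //; apply: ht.
rewrite exchange_big; apply: ler_sum => i _ /=.
have h := bessel hb (a i) ut; have hai := pon_norm_le ha i.
apply: (@le_trans _ _ (\sum_(j <- t) qn (inner (b j) (a i)))).
  apply: ler_sum => j _; rewrite -[leRHS]mul1r ler_wpM2r ?qn_ge0 //.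
  by rewrite exprn_ile1.
apply: (@le_trans _ _ (`|\sum_(j <- t) b j *q inner (a i) (b j)| ^+ 2)); last first.
  by rewrite exprn_ile1 //; apply: le_trans hai.
rewrite (pon_norm hb) // big_seq [leRHS]big_seq; apply: ler_sum => j /ht /(pon_unit hb) hj.
by rewrite normE2 /ip hj mul1r inner_conj qn_conj.
Qed.

(** An infinite index set dominates any countable one, so only the finite case calls for
    [pon_size_le]; there a larger [b] would contain a finite subfamily that is too large. *)
Lemma card_le_pon (I J : countType) (a : I -> H) (b : J -> H) V :
  pon a -> pon b -> csub V -> (forall i, V (a i)) -> total a V ->
  (forall j, V (b j)) -> ([set j | b j <> 0] #<= [set i | a i <> 0])%card.
Proof.
move=> ha hb hV Va ta Vb; set A := [set i | a i <> 0]; set B := [set j | b j <> 0].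
have [Af|/infiniteP Ai] := pselect (finite_set A); last first.
  exact: card_le_trans (countableP B) Ai.
pose r := enum_fset (fset_set A).
have ur : uniq r by apply: fset_uniq.
have hr i : a i <> 0 -> i \in r by move=> h; rewrite in_fset_set // inE.
have key (X : {fset J}) : [set` X] `<=` B -> (#|` X| <= size r)%N.
  move=> XB; apply: (pon_size_le ha hb hV Va ta Vb ur hr (fset_uniq X)) => j jX.
  exact: (XB j).
have Bf : finite_set B.
  apply: contrapT => /(infinite_set_fset (size r).+1) [X XB].
  by rewrite leqNgt ltnS key.
have [n An] := (finite_setP A).1 Af; have [m Bm] := (finite_setP B).1 Bf.
rewrite (card_le_eql Bm) (card_le_eqr An) card_le_II.
rewrite -(card_fset_set Bm) -(card_fset_set An); apply: key.
by rewrite fset_setK.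
Qed.

Lemma card_eq_pon (I J : countType) (a : I -> H) (b : J -> H) V :
  pon a -> pon b -> csub V -> (forall i, V (a i)) -> total a V ->
  (forall j, V (b j)) -> total b V ->
  ([set i | a i <> 0] #= [set j | b j <> 0])%card.
Proof. by move=> *; rewrite card_eq_le; apply/andP; split; exact: (card_le_pon (V := V)). Qed.

(** A bijection carries the two summands back to a partition of [A]; [b] becomes the next bit of
    each index. *)
Lemma card_split (A : set nat) (C : set (nat + nat)) : (A #= C)%card ->
  exists b : nat -> bool,
    ([set m | A m /\ b m = false] #= [set k | C (inl k)])%card /\
    ([set m | A m /\ b m = true] #= [set k | C (inr k)])%card.
Proof.
rewrite card_eq_sym => /card_set_bijP [f [fC fi fs]].
pose b m := `[< exists2 k, C (inr k) & f (inr k) = m >].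
exists b; split.
  rewrite (_ : [set m | _] = (f \o inl) @` [set k | C (inl k)]).
    apply: inj_card_eq => k k'; rewrite !inE => hk hk' e.
    by have [] := fi _ _ (mem_set hk) (mem_set hk') e.
  apply/seteqP; split=> [m [Am /asboolP bm]|_ [k Ck <-]] /=.
    have [[k|k] Ck e] := fs m Am; first by exists k.
    by case: bm; exists k.
  split; first exact: fC.
  apply/asboolP => -[k' Ck' e]; by have := fi _ _ (mem_set Ck') (mem_set Ck) e.
rewrite (_ : [set m | _] = (f \o inr) @` [set k | C (inr k)]).
  apply: inj_card_eq => k k'; rewrite !inE => hk hk' e.
  by have [] := fi _ _ (mem_set hk) (mem_set hk') e.
apply/seteqP; split=> [m [Am /asboolP [k Ck <-]]|_ [k Ck <-]] /=; first by exists k.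
by split; [exact: fC|apply/asboolP; exists k].
Qed.

End Cardinality.

(** * The binary tree and the bases of its levels *)

Section Tree.
Variables (R : realType) (H : rightQHilbertType R).
Implicit Types (x y z : H) (w : seq bool).
Hypothesis Hsep : separable_space H.
Hypothesis Hinf : infinite_dimensional H.
Variables (B Q : H -> H) (rho : nat -> H -> H).
Hypotheses (Bbop : bounded_operator B) (Qbop : bounded_operator Q).
Hypotheses (Badj : adj B (fun x => - B x)) (Qadj : adj Q Q).
Hypotheses (QB : comm Q B) (QQ : forall x, Q (Q x) = - B (B x)).
Hypotheses (rhoI : forall k, involution (rho k)).
Hypotheses (rhoC : forall k l, comm (rho k) (rho l)).
Hypotheses (rhoB : forall k, comm (rho k) B) (rhoQ : forall k, comm (rho k) Q).

Definition cell w : set H :=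
  [set x | forall k, (k < size w)%N -> rho k x = (-1) ^+ nth false w k *: x].

Let rho_bop k : bounded_operator (rho k). Proof. by case: (rhoI k). Qed.
Let rho_lin k : lin (rho k). Proof. exact: bop_lin. Qed.

Lemma cell_rcons w b x :
  cell (rcons w b) x <-> cell w x /\ rho (size w) x = (-1) ^+ b *: x.
Proof.
split=> [h|[h1 h2] k].
  split=> [k kw|].
    have := h k; rewrite size_rcons nth_rcons kw => /(_ (ltnW kw)); exact.
  by have := h (size w); rewrite size_rcons nth_rcons ltnn eqxx ltnSn => /(_ isT).
rewrite size_rcons ltnS leq_eqVlt nth_rcons => /orP[/eqP->|kw].
  by rewrite ltnn eqxx.
by rewrite kw; apply: h1.
Qed.

Lemma csub_cell w : csub (cell w).
Proof.
elim/last_ind: w => [|w b IH].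
  by rewrite (_ : cell _ = setT) //; apply/seteqP; split.
rewrite (_ : cell _ = cell w `&` [set x | rho (size w) x = (-1) ^+ b *: x]).
  apply: csubI => //; apply: (csub_eq (T := fun x => (-1) ^+ b *: x)) => //.
  by apply: (@bop_scale _ _ _ idfun); apply: bop_id.
by apply/seteqP; split=> x /cell_rcons.
Qed.

Lemma cell_comm Z w : lin Z -> (forall k, comm (rho k) Z) ->
  forall x, cell w x -> cell w (Z x).
Proof. by move=> lZ cZ x h k kw; rewrite cZ h // (linZ lZ). Qed.

(** Where the words differ, [x] and [y] are eigenvectors of a self-adjoint [rho k] for opposite
    eigenvalues. *)
Lemma cell_orth w w' x y : size w = size w' -> w != w' ->
  cell w x -> cell w' y -> inner x y = 0.
Proof.
move=> sw ww hx hy.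
have [k kw kne] : exists2 k, (k < size w)%N & nth false w k <> nth false w' k.
  apply: contrapT => h; move/eqP: ww; apply; apply: (@eq_from_nth _ false) => // k kw.
  by apply: contrapT => h'; apply: h; exists k.
have ex := hx k kw; have := hy k; rewrite -sw => /(_ kw) ey.
have [_ a _] := rhoI k; have := a x y; rewrite ex ey.
have rN (z z' : H) : inner z z' = - inner z z' -> inner z z' = 0.
  by case: (inner z z') => ? ? ? ? [] *; apply: quatP => /=; lra.
case: (nth false w k) (nth false w' k) kne => [] [] //= _;
  rewrite expr0 expr1 scaleN1r scale1r ?innerNl ?innerNr => e; exact: rN.
Qed.

(** A vector of a cell is half the sum of [x + rho n x] and [x - rho n x], which lie in its two
    children. *)
Lemma cell_cover n (V : set H) : csub V ->
  (forall w, size w = n -> cell w `<=` V) -> forall x, V x.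
Proof.
move=> hV; case: (hV) => _ VD VS _; elim: n => [|n IH] h.
  by move=> x; apply: (h [::]).
apply: IH => w sw x wx.
have [_ _ rK] := rhoI n.
have -> : x = 2^-1 *: (x + rho n x) + 2^-1 *: (x - rho n x).
  have e2 : x + x = 2 *: x by rewrite scaler_nat mulr2n.
  by rewrite -scalerDr addrACA subrr addr0 e2 scalerA mulVf ?scale1r // pnatr_eq0.
have rw : cell w (rho n x) by apply: cell_comm => // k; apply: rhoC.
have hw := csub_cell w; have [_ wD wS _] := hw.
rewrite -!rscale_r; apply: VD; apply: VS.
  apply: (h (rcons w false)); rewrite ?size_rcons ?sw //.
  apply/cell_rcons; rewrite sw; split; first exact: wD.
  by rewrite (linD (rho_lin n)) rK expr0 scale1r addrC.
apply: (h (rcons w true)); rewrite ?size_rcons ?sw //.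
apply/cell_rcons; rewrite sw; split; first exact: (csubB hw).
by rewrite (linB (rho_lin n)) rK expr1 scaleN1r opprB.
Qed.

(** The order of quantifiers is the point: one table of signs [s] serves all levels, while the basis
    [f] may change with [n]. *)
Lemma tree_bases : exists s : nat -> nat -> bool, forall n, exists f : nat -> H,
  [/\ forall m m', inner (f m) (f m') = (m == m')%:R, total f setT,
      forall m, adapted B Q (f m) &
      forall k m, (k < n)%N -> rho k (f m) = (-1) ^+ s k m *: f m].
Proof.
have [g gP] : {g : seq bool -> nat -> H & forall w, [/\ pon (g w),
    forall i, cell w (g w i), forall i, adapted B Q (g w i) & total (g w) (cell w)]}.
  apply: (choice (P := fun w g => [/\ pon g, forall i, cell w (g i),
    forall i, adapted B Q (g i) & total g (cell w)])) => w.
  apply: adapted_basis => //; first exact: csub_cell.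
    by apply: cell_comm; [exact: bop_lin|].
  by apply: cell_comm; [exact: bop_lin|].
pose G w := [set k | g w k <> 0].
(* Infinite dimension enters here: the basis of the root has as many nonzero vectors as there are
   indices. *)
have G0 : ([set: nat] #= G [::])%card.
  have [pg _ _ tg] := gP [::].
  have cT x : cell [::] x by [].

  have Gc : (G [::] #<= [set: nat])%card := countableP _.
  rewrite card_eq_le Gc andbT; apply/infiniteP => Gf.
  pose r := enum_fset (fset_set (G [::])).
  have ur : uniq r by apply: fset_uniq.
  have hr k : g [::] k <> 0 -> k \in r by move=> h; rewrite in_fset_set // inE.
  apply: (Hinf (v := fun i : 'I_(size r) => g [::] (nth 0%N r i))).
  apply/seteqP; split=> // x _.
  exists (fun i : 'I_(size r) => inner x (g [::] (nth 0%N r i))).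
  rewrite [LHS](pon_finite_expand pg (csub_cell [::]) (fun i => cT _) tg ur hr (cT x)).
  by rewrite (big_nth 0%N) big_mkord.
(* The bases of the two children form together a basis of the parent, so the dimensions add up. *)
have GS w : (G w #= [set i : nat + nat | match i with
    | inl k => g (rcons w false) k | inr k => g (rcons w true) k end <> 0])%card.
  have [pg cg ag tg] := gP w; have [pg0 cg0 _ tg0] := gP (rcons w false).
  have [pg1 cg1 _ tg1] := gP (rcons w true).
  apply: (card_eq_pon (V := cell w)) => //.
  - split=> [[i|i] [j|j] ij|[i|i]] /=; try by [apply: (proj2 pg0)|apply: (proj2 pg1)].
    + by apply: (proj1 pg0).
    + apply: (@cell_orth (rcons w false) (rcons w true)) => //.
        by rewrite !size_rcons.
      by rewrite eqseq_rcons andbF.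
    + apply: (@cell_orth (rcons w true) (rcons w false)) => //.
        by rewrite !size_rcons.
      by rewrite eqseq_rcons andbF.
    by apply: (proj1 pg1).
  - exact: csub_cell.
  - by move=> [i|i] /=; [have /cell_rcons[] := cg0 i|have /cell_rcons[] := cg1 i].
  move=> x wx hx.
  have [_ _ rK] := rhoI (size w).
  have rw : cell w (rho (size w) x) by apply: cell_comm => // k; apply: rhoC.
  have [_ wD _ _] := csub_cell w.
  have [_ ra _] := rhoI (size w).
  have e0 : x + rho (size w) x = 0.
    apply: tg0 => [|k].
      apply/cell_rcons; split; first exact: wD.
      by rewrite (linD (rho_lin _)) rK expr0 scale1r addrC.
    have /cell_rcons[_ ek] := cg0 k.
    by rewrite innerDl ra ek expr0 scale1r (hx (inl k)) addr0.
  have e1 : x - rho (size w) x = 0.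
    apply: tg1 => [|k].
      apply/cell_rcons; split; first exact: (csubB (csub_cell w)).
      by rewrite (linB (rho_lin _)) rK expr1 scaleN1r opprB.
    have /cell_rcons[_ ek] := cg1 k.
    by rewrite innerBl ra ek expr1 scaleN1r innerNr (hx (inr k)) oppr0 subr0.
  have : x + x = 0.
    by rewrite -[RHS](addr0 0) -{1}e0 -e1 addrACA subrr addr0.
  have -> : x + x = (2 : R) *: x by rewrite scaler_nat mulr2n.
  by move=> /eqP; rewrite scaler_eq0 pnatr_eq0 => /eqP.
(* [c m] is the word of length [n] assigned to index [m]; each cell receives as many indices as its
   dimension. *)
pose good n (c : nat -> seq bool) := (forall m, size (c m) = n) /\
  forall w, size w = n -> ([set m | c m = w] #= G w)%card.
have [F FP] : {F : nat * (nat -> seq bool) -> nat -> bool &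
    forall p, good p.1 p.2 -> good p.1.+1 (fun m => rcons (p.2 m) (F p m))}.
  apply: (choice (P := fun p F => good p.1 p.2 ->
    good p.1.+1 (fun m => rcons (p.2 m) (F m)))) => -[n c] /=.
  have [gd|ng] := pselect (good n c); last by exists xpred0.
  have [bb bbP] : {bb : seq bool -> nat -> bool & forall w, size w = n ->
    ([set m | c m = w /\ bb w m = false] #= G (rcons w false))%card /\
    ([set m | c m = w /\ bb w m = true] #= G (rcons w true))%card}.
    apply: (choice (P := fun w b => size w = n ->
      ([set m | c m = w /\ b m = false] #= G (rcons w false))%card /\
      ([set m | c m = w /\ b m = true] #= G (rcons w true))%card)) => w.
    have [sw|sw] := eqVneq (size w) n; last by exists xpred0 => /eqP; rewrite (negPf sw).
    have [b hb] := card_split (card_eq_trans (gd.2 w sw) (GS w)).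
    by exists b.
  exists (fun m => bb (c m) m) => _; split=> [m|w]; first by rewrite size_rcons gd.1.
  case/lastP: w => // w b; rewrite size_rcons => -[sw].
  rewrite (_ : [set m | _] = [set m | c m = w /\ bb w m = b]).
    by have [h1 h2] := bbP w sw; case: b.
  apply/seteqP; split=> m /=; first by move=> /rcons_inj[-> ->].
  by move=> [-> ->].
pose c := fix c n := if n is n'.+1 then
  fun m => rcons (c n' m) (F (n', c n') m) else fun=> [::].
have gc n : good n (c n).
  elim: n => [|n IH]; last exact: FP (n, c n) IH.
  split=> // w /size0nil ->; rewrite (_ : [set m | _] = setT) //.
  by apply/seteqP; split.
(* Words only grow by [rcons], so bit [k] is settled from level [k.+1] on. *)
pose s k m := nth false (c k.+1 m) k.
have cs n k m : (k < n)%N -> nth false (c n m) k = s k m.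
  elim: n => // n IH; rewrite ltnS leq_eqVlt => /orP[/eqP-> //|kn].
  by rewrite /= nth_rcons (gc n).1 kn IH.
exists s => n.
(* At a fixed level, the indices assigned to a cell are matched with the nonzero vectors of its
   basis. *)
have [phi phiP] : {phi : seq bool -> nat -> nat & forall w, size w = n ->
    set_bij [set m | c n m = w] (G w) (phi w)}.
  apply: (choice (P := fun w phi => size w = n ->
    set_bij [set m | c n m = w] (G w) phi)) => w.
  have [sw|sw] := eqVneq (size w) n; last by exists id => /eqP; rewrite (negPf sw).
  by have /card_set_bijP[phi h] := (gc n).2 w sw; exists phi.
pose f m := g (c n m) (phi (c n m) m).
have fcell m : cell (c n m) (f m) by have [_ h _ _] := gP (c n m); apply: h.
exists f; split.
- move=> m m'; have [<-|mm] := eqVneq m m'.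
    have [pg _ _ _] := gP (c n m); have [h _ _] := phiP _ ((gc n).1 m).
    by rewrite (pon_unit pg) //; apply: h.
  have [e|ne] := eqVneq (c n m) (c n m'); last first.
    by apply: cell_orth (fcell m) (fcell m') => //; rewrite !(gc n).1.
  have [pg _ _ _] := gP (c n m'); have [_ h _] := phiP _ ((gc n).1 m').
  rewrite /f e; apply: (proj1 pg); apply: contra mm => /eqP e'.
  by apply/eqP; apply: h e'; rewrite inE.
- move=> x _ hx; apply: inner_eq0.
  (* Orthogonality to [x] is written [inner y x = inner y 0] to be an instance of [csub_inner_eq];
     it is then checked on the basis of each cell. *)
  have hV := csub_inner_eq x 0 (@bop_id _ H).
  suff : [set y | inner y x = inner y 0] x by rewrite /= inner0r.
  apply: (cell_cover (n := n) hV) => w sw.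
  have [pg cg _ tg] := gP w; have [_ _ h] := phiP w sw.
  apply: (total_sub pg (csub_cell w) cg tg hV) => k /=; rewrite inner0r.
  have [->|/eqP gk] := eqVneq (g w k) 0; first by rewrite inner0l.
  have [m cm <-] := h k gk.
  by apply: inner_eq0C; have := hx m; rewrite /f cm.
- by move=> m; have [_ _ h _] := gP (c n m); apply: h.
by move=> k m kn; have := fcell m k; rewrite (gc n).1 cs // => /(_ kn).
Qed.

End Tree.

(** * Diagonal operators *)

Section DiagonalOperators.
Variables (R : realType) (H : rightQHilbertType R).
Implicit Types (x y z : H) (e f : nat -> H) (d : nat -> quat R).

Definition onb f := (forall m n, inner (f m) (f n) = (m == n)%:R) /\ total f setT.

Lemma onb_pon f : onb f -> pon f.
Proof.
move=> [h _]; split=> [i j /negPf ij|i]; first by rewrite h ij.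
by right; rewrite h eqxx.
Qed.

Lemma onb_eq f x y : onb f -> (forall k, inner x (f k) = inner y (f k)) -> x = y.
Proof.
move=> [_ ht] h; apply/eqP; rewrite -subr_eq0; apply/eqP/ht => // k.
by rewrite innerBl h subrr.
Qed.

Lemma bop_onb_eq f S T : onb f -> bounded_operator S -> bounded_operator T ->
  (forall k, S (f k) = T (f k)) -> S =1 T.
Proof.
move=> hf hS hT h x; have [_ ft] := hf.
exact: (total_sub (onb_pon hf) (@csubT _ _) _ ft (csub_eq hS hT) h).
Qed.

Lemma onb_basis f : onb f -> orthonormal_basis f.
Proof.
move=> hf; have [h ft] := hf; split=> // O [x Ox] Oo.
have hx := @proj_cvg _ _ _ (onb_pon hf) x.
rewrite (total_proj (onb_pon hf) (@csubT _ _) _ ft) // in hx.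
have [N _ hN] := hx O (open_nbhs_nbhs (conj Oo Ox)).
exists (psum f (fun k => inner x (f k)) N); split; first exact: (hN N (leqnn N)).
by exists N => //; exists (fun k : 'I_N => inner x (f k)); rewrite /psum big_mkord.
Qed.

(** It sends [e m] to [f m] times [d m]. Two bases are allowed so that diagonal operators ([e = f])
    and unitary changes of basis ([d = 1]) share their estimates. *)
Definition diag e f d x : H := fsum f (fun m => d m * inner x (e m)).

Section Diag.
Variables (e f : nat -> H) (d : nat -> quat R) (K : R).
Hypotheses (he : onb e) (hf : onb f) (K0 : 0 <= K).
Hypothesis dK : forall m, qn (d m) <= K ^+ 2.

Lemma diag_psum x n : `|psum f (fun m => d m * inner x (e m)) n| <= K * `|x|.
Proof.
apply: le_norm2; first exact: mulr_ge0.
rewrite (pon_norm (onb_pon hf)) ?iota_uniq // exprMn.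
have nE g i : onb g -> `|g i| ^+ 2 = 1.
  by move=> [hg _]; rewrite normE2 /ip hg eqxx.
have h := bessel (onb_pon he) x (iota_uniq 0 n).
apply: (@le_trans _ _ (K ^+ 2 * `|psum e (fun m => inner x (e m)) n| ^+ 2)).
  rewrite (pon_norm (onb_pon he)) ?iota_uniq // mulr_sumr; apply: ler_sum => i _.
  by rewrite !nE // !mul1r qnM ler_wpM2r // qn_ge0.
rewrite ler_wpM2l ?sqr_ge0 // ler_sqr ?nnegrE //.
by move: h; rewrite /psum /index_iota subn0.
Qed.

Lemma diag_inner x k : inner (diag e f d x) (f k) = d k * inner x (e k).
Proof.
rewrite /diag (fsum_inner (onb_pon hf) _ (diag_psum x)).
by have [h _] := hf; rewrite h eqxx mul1r.
Qed.

Lemma diag_bnd : bnd K (diag e f d).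
Proof. by move=> x; apply: (fsum_norm (onb_pon hf) (diag_psum x)). Qed.

Lemma diag_bop : bounded_operator (diag e f d).
Proof.
apply: bnd_bop diag_bnd => x y q; apply: (onb_eq hf) => k.
by rewrite innerDl innerZl !diag_inner innerDl innerZl mulrDr mulrA.
Qed.

Lemma diag_basis k : diag e f d (e k) = f k *q d k.
Proof.
apply: (onb_eq hf) => j; rewrite diag_inner innerZl.
have [[h _] [h' _]] := (he, hf); rewrite h h'.
by have [->|_] := eqVneq k j; rewrite ?mulr1 ?mul1r ?mulr0 ?mul0r.
Qed.

End Diag.

Lemma diag_eigen_bnd f d (K : R) T : onb f -> 0 <= K -> (forall m, qn (d m) <= K ^+ 2) ->
  bounded_operator T -> (forall k, T (f k) = f k *q d k) -> bnd K T.
Proof.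
move=> hf K0 dK hT h x.
rewrite (bop_onb_eq hf hT (diag_bop hf hf K0 dK)); first exact: diag_bnd.
by move=> k; rewrite h (diag_basis hf hf K0 dK).
Qed.

Definition transport e f := diag e f (fun=> 1).

Lemma transport_bop e f : onb e -> onb f -> bounded_operator (transport e f).
Proof. by move=> he hf; apply: (diag_bop he hf ler01) => m; rewrite qn1 expr1n. Qed.

Lemma transport_inner e f x k : onb e -> onb f ->
  inner (transport e f x) (f k) = inner x (e k).
Proof.
move=> he hf; rewrite (diag_inner he hf ler01) ?mul1r // => m.
by rewrite qn1 expr1n.
Qed.

Lemma transport_basis e f k : onb e -> onb f -> transport e f (e k) = f k.
Proof.
move=> he hf; rewrite /transport (diag_basis he hf ler01) ?rscale1 // => m.
by rewrite qn1 expr1n.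
Qed.

Lemma transport_adj e f : onb e -> onb f -> adj (transport e f) (transport f e).
Proof.
move=> he hf x y; have [_ et] := he.
have hV := csub_inner_eq y (transport f e y) (transport_bop he hf).
apply: (total_sub (onb_pon he) (@csubT _ _) _ et hV) => // k /=.
by rewrite transport_basis // [in RHS]inner_conj transport_inner // -inner_conj.
Qed.

Lemma transportK e f : onb e -> onb f -> cancel (transport e f) (transport f e).
Proof. by move=> he hf x; apply: (onb_eq he) => k; rewrite !transport_inner. Qed.

Lemma transport_unitary e f : onb e -> onb f -> unitary_operator (transport e f).
Proof.
move=> he hf; rewrite /unitary_operator (adjointE (transport_adj he hf)).
split; first exact: transport_bop.
  by apply/funext => x /=; rewrite transportK.
by apply/funext => x /=; rewrite transportK.
Qed.

Lemma opnorm_le (c : R) (X : H -> H) : bnd c X -> 0 <= c -> 0 <= opnorm X <= c.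
Proof.
move=> hX c0; pose E := [set `|X x| | x in [set x : H | `|x| <= 1]].
have Ec : ubound E c.
  move=> _ [x /= x1 <-]; apply: (le_trans (hX x)).
  by rewrite -[leRHS]mulr1 ler_wpM2l.
have E0 : E `|X 0| by exists 0; rewrite //= normr0.
apply/andP; split; last by apply: ge_sup => //; exists `|X 0|.
by apply: (@le_trans _ _ `|X 0|) => //; apply: ub_le_sup => //; exists c.
Qed.

End DiagonalOperators.

(** The intervals of radius [r / 2 ^+ n] about the partial sums are nested; the limit is the
    supremum of their left endpoints. *)
Lemma binary_limit (R : realType) (r : R) (s : nat -> bool) : 0 <= r ->
  exists l, forall n, `|l - \sum_(i < n) r / 2 ^+ i.+1 * (-1) ^+ s i| <= r / 2 ^+ n.
Proof.
move=> r0; pose u n := \sum_(i < n) r / 2 ^+ i.+1 * (-1) ^+ s i.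
have p0 n : 0 <= r / 2 ^+ n by rewrite divr_ge0 // exprn_ge0.
have half n : r / 2 ^+ n = r / 2 ^+ n.+1 + r / 2 ^+ n.+1.
  by rewrite exprSr invfM mulrA; lra.
have uS n : u n.+1 = u n + r / 2 ^+ n.+1 * (-1) ^+ s n by rewrite /u big_ord_recr.
have lo n m : (n <= m)%N -> u n - r / 2 ^+ n <= u m - r / 2 ^+ m.
  apply: (homo_leq (f := fun n => u n - r / 2 ^+ n) (@lexx _ R) (@le_trans _ R)) => k.
  rewrite uS (half k); have := p0 k.+1.
  by case: (s k); rewrite ?expr0 ?expr1; lra.
have hi n m : (n <= m)%N -> u m + r / 2 ^+ m <= u n + r / 2 ^+ n.
  apply: (homo_leq (f := fun n => u n + r / 2 ^+ n) (r := fun a b => b <= a)) => [||k].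
  - exact: lexx.
  - by move=> a b c ba cb; apply: le_trans cb ba.
  rewrite uS (half k); have := p0 k.+1.
  by case: (s k); rewrite ?expr0 ?expr1; lra.
have lohi n m : u n - r / 2 ^+ n <= u m + r / 2 ^+ m.
  have [nm|/ltnW mn] := leqP n m.
    by apply: (le_trans (lo _ _ nm)); have := p0 m; lra.
  by apply: (le_trans _ (hi _ _ mn)); have := p0 n; lra.
pose E := range (fun n => u n - r / 2 ^+ n).
exists (sup E) => n; rewrite -/(u n) ler_distl; apply/andP; split.
  by apply: ub_le_sup; [exists (u 0 + r / 2 ^+ 0) => _ [m _ <-]|exists n].
by apply: ge_sup; [exists (u 0 - r / 2 ^+ 0), 0%N|move=> _ [m _ <-]].
Qed.

(** * Normal operators *)

Section NormalOperators.
Variables (R : realType) (H : rightQHilbertType R).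
Implicit Types (x y z : H) (S T : H -> H).

Lemma adj_bnd (M : R) T T' : adj T T' -> bnd M T -> bnd M T'.
Proof.
move=> aT bT x; have [->|T'x] := eqVneq (T' x) 0.
  by rewrite normr0; apply: le_trans (bT x).
have p : 0 < `|T' x| by rewrite normr_gt0.
rewrite -(ler_pM2r p) -expr2 normE2 -(adj_ip aT); apply: (le_trans (ip_le _ _)).
by rewrite mulrAC ler_wpM2r.
Qed.

Lemma bnd_half (M : R) S T : bnd M S -> bnd M T ->
  bnd M (fun x => 2^-1 *: (S x + T x)).
Proof.
move=> hS hT x; rewrite normrZ ger0_norm ?invr_ge0 // ler_pdivrMl //.
apply: (le_trans (ler_normD _ _)); have := hS x; have := hT x; lra.
Qed.

Lemma comm_half (a : R) S T T' : bounded_operator S -> comm S T -> comm S T' ->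
  comm S (fun x => a *: (T x + T' x)).
Proof. by move=> /bop_lin lS h h' x; rewrite (linZ lS) (linD lS) h h'. Qed.

(* [Q = |B|]; the common eigenspaces of the involutions replace the joint spectral
   measure of [A] and [Q]. Centering [Q] at [M/2] keeps the eigenvalues of its
   approximants nonnegative. *)
Lemma normal_expansion (Hsep : separable_space H) T : bounded_operator T ->
  normal_operator T ->
  exists (M : R) (A B Q : H -> H) (rho : nat -> H -> H),
  [/\ 0 < M,
      [/\ bounded_operator A, bounded_operator B, bounded_operator Q &
        forall x, T x = A x + B x],
      [/\ adj B (fun x => - B x), adj Q Q, comm Q B & forall x, Q (Q x) = - B (B x)],
      [/\ forall k, involution (rho k), forall k l, comm (rho k) (rho l),
        forall k, comm (rho k) B & forall k, comm (rho k) Q] &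
      forall n, bnd (M / 2 ^+ n)
        (fun x => A x - \sum_(i < n) (M / 2 ^+ i.+1) *: rho i.*2 x) /\
      bnd (M / 2 / 2 ^+ n) (fun x => Q x - ((M / 2) *: x +
        \sum_(i < n) (M / 2 / 2 ^+ i.+1) *: rho i.*2.+1 x))].
Proof.
move=> hT nT; have [T' hT' aT] := exists_adj Hsep hT.
have TT' x : T' (T x) = T (T' x).
  by move: nT; rewrite /normal_operator (adjointE aT) => /(congr1 (@^~ x)).
have [M M0 bT] := bop_bnd hT; have bT' := adj_bnd aT bT.
have aT' := adj_sym aT.
have [lT lT'] := (bop_lin hT, bop_lin hT').
pose A x := 2^-1 *: (T x + T' x); pose B x := 2^-1 *: (T x - T' x).
have hA : bounded_operator A by apply: bop_scale; apply: bop_add.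
have hB : bounded_operator B by apply: bop_scale; apply: bop_sub.
have [lA lB] := (bop_lin hA, bop_lin hB).
have aA : adj A A.
  apply: adj_scale => x y; rewrite (adj_add aT aT' x y); congr inner.
  by rewrite addrC.
have aB : adj B (fun x => - B x).
  move=> x y; rewrite (adj_scale 2^-1 (adj_sub aT aT') x y); congr inner.
  by rewrite /B -scalerN opprB.
have bA : bnd M A by apply: bnd_half.
have bB : bnd M B.
  by apply: (bnd_half (T := fun x => - T' x)) => // x; rewrite normrN.
(* Normality is used here; it makes [A] commute with [B], hence with [Q], and finally the two
   expansions with each other. *)
have BA : comm B A.
  have cT : comm B T by move=> x; rewrite /B (linZ lT) (linB lT) TT'.
  have cT' : comm B T' by move=> x; rewrite /B (linZ lT') (linB lT') TT'.
  exact: comm_half.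
have hBN : bounded_operator (fun x => - B x) by apply: bop_opp.
have bBN : bnd M (fun x => - B x) by move=> x; rewrite normrN.
have [Q [hQ aQ QQ pQ cQ]] := exists_abs M0 hB hBN aB bB bBN.
have lQ := bop_lin hQ.
have BQ : comm B Q by apply: cQ => // x; rewrite (linN lB).
have AQ : comm A Q by apply: cQ => // x; rewrite (linN lA) -!BA.
have bQ : bnd M Q.
  move=> x; apply: (le_trans _ (bB x)); apply: le_norm2 => //.
  by rewrite !normE2 (adj_ip aQ) QQ (adj_ip aB).
have M2 : 0 < M / 2 by rewrite divr_gt0.
pose S x := Q x - (M / 2) *: x.
have hS : bounded_operator S.
  by apply: bop_sub => //; apply: (@bop_scale _ _ _ idfun); apply: bop_id.
have aS : adj S S.
  by apply: adj_sub => //; apply: (@adj_scale _ _ _ idfun idfun); apply: adj_id.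
have bS : bnd (M / 2) S by apply: positive_bnd.
have cS Z : lin Z -> comm Z Q -> comm Z S.
  by move=> lZ cZ x; rewrite /S (linB lZ) (linZ lZ) cZ.
have [sg [sgI sgE sgC]] := exists_expansion Hsep M0 hA aA bA.
have [ta [taI taE taC]] := exists_expansion Hsep M2 hS aS bS.
have cC X Y : comm X Y -> comm Y X by move=> h x; rewrite h.
have sgB k : comm (sg k) B by apply/cC/(sgC k _ _ hB aB BA).
have sgQ k : comm (sg k) Q by apply/cC/(sgC k _ _ hQ aQ)/cC.
have taB k : comm (ta k) B by apply/cC/(taC k _ _ hB aB)/cS.
have taQ k : comm (ta k) Q by apply/cC/(taC k _ _ hQ aQ)/cS.
(* The commutation clause is used twice: with [A] itself to see that [sg k] commutes with [A], then
   with [sg k] as the commuting operator. *)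
have sgsg k l : comm (sg k) (sg l).
  have [h a _] := sgI k; apply: (sgC l _ _ h a); apply/cC/(sgC k _ _ hA aA) => x.
  by [].
have sgta k l : comm (sg k) (ta l).
  by have [h a _] := sgI k; apply: (taC l _ _ h a); apply: cS => //; apply: bop_lin.
have tata k l : comm (ta k) (ta l).
  by have [h a _] := taI k; apply: (taC l _ _ h a); apply: cS => //; apply: bop_lin.
(* Interleaving gives a single sequence whose first [2 n] terms are the first [n] digits of both
   expansions. *)
pose rho k := if odd k then ta k./2 else sg k./2.
have rhoe i : rho i.*2 = sg i by rewrite /rho odd_double doubleK.
have rhoo i : rho i.*2.+1 = ta i by rewrite /rho /= odd_double /= uphalf_double.
exists M, A, B, Q, rho; split=> //.
- split=> // x; rewrite /A /B -scalerDr addrACA subrr addr0.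
  have -> : T x + T x = 2 *: T x by rewrite scaler_nat mulr2n.
  by rewrite scalerA mulVf ?scale1r // pnatr_eq0.
- by split=> //; apply: cC.
- rewrite /rho; split=> [k|k l|k|k]; case: ifP => _ //.
  by case: ifP => _ //; apply: cC.
  by case: ifP => _ //; apply: cC.
move=> n; split=> x.
  by under eq_bigr do rewrite rhoe; apply: sgE.
under eq_bigr do rewrite rhoo.
by rewrite opprD addrA; apply: taE.
Qed.

End NormalOperators.

Theorem proposition4p1 (R : realType) (H : rightQHilbertType R)
    (H_separable : separable_space H) (H_infinite : infinite_dimensional H)
    (T : H -> H) (T_bounded : bounded_operator T)
    (T_normal : normal_operator T) :
  exists (e : nat -> H) (D : H -> H) (d : nat -> quat R),
    [/\ orthonormal_basis e, bounded_operator D, diagonal_operator D e d,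
        (forall n, in_Cplus (d n)) & approx_unitary_equiv T D].
Proof.
have [M [A [B [Q [rho [M0 [hA hB hQ TE] [aB aQ QB QQ] [rhoI rhoC rhoB rhoQ] rhoE]]]]]] :=
  normal_expansion H_separable T_bounded T_normal.
have [s sP] := tree_bases H_separable H_infinite hB hQ aB aQ QB QQ rhoI rhoC rhoB rhoQ.
have M2 : 0 < M / 2 by rewrite divr_gt0.
have /choice[a aP] : forall m, exists l, forall n, `|l -
    \sum_(i < n) M / 2 ^+ i.+1 * (-1) ^+ s i.*2 m| <= M / 2 ^+ n.
  by move=> m; apply: (binary_limit (fun i => s i.*2 m)); apply: ltW.
have /choice[b bP] : forall m, exists l, forall n, `|l -
    \sum_(i < n) M / 2 / 2 ^+ i.+1 * (-1) ^+ s i.*2.+1 m| <= M / 2 / 2 ^+ n.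
  by move=> m; apply: (binary_limit (fun i => s i.*2.+1 m)); apply: ltW.
(* The real part is the value of branch [m] under the expansion of [A], the imaginary part that
   under [Q], recentered by [M / 2]. As [b m] is at most [M / 2] in absolute value, the imaginary
   part is nonnegative. *)
pose d m := qc (a m) (M / 2 + b m).
have absa m : `|a m| <= M by have := aP m 0; rewrite big_ord0 subr0 expr0 divr1.
have absb m : `|b m| <= M / 2 by have := bP m 0; rewrite big_ord0 subr0 expr0 divr1.
have sq_le (u v : R) : `|u| <= v -> u ^+ 2 <= v ^+ 2.
  move=> uv; rewrite -[u ^+ 2]real_normK ?num_real // ler_sqr ?nnegrE //.
  exact: le_trans uv.
(* The true constant is 2; the square 4 gives a norm bound without a square root. *)
have sq_add (u v w : R) : u <= w ^+ 2 -> v <= w ^+ 2 -> u + v <= 2 ^+ 2 * w ^+ 2.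
  by have := sqr_ge0 w; lra.
have four (u : R) : u + u + 2 * u <= 4 * u by lra.
have dbnd m : qn (d m) <= (2 * M) ^+ 2.
  have h1 := sq_le _ _ (absa m).
  have h2 : (M / 2 + b m) ^+ 2 <= M ^+ 2.
    apply: sq_le; apply: (le_trans (ler_normD _ _)); have := absb m.
    by rewrite (ger0_norm (ltW M2)); lra.
  by rewrite qn_qc exprMn; apply: sq_add.
have M20 : 0 <= 2 * M by rewrite mulr_ge0 // ltW.
have /choice[f fP] : forall n, exists f : nat -> H, [/\ onb f,
    forall m, adapted B Q (f m) &
    forall k m, (k < n.*2)%N -> rho k (f m) = (-1) ^+ s k m *: f m].
  by move=> n; have [f [h1 h2 h3 h4]] := sP n.*2; exists f.
have hf n : onb (f n) by case: (fP n).
pose e := f 0; have he : onb e := hf 0.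
pose D := diag e e d.
have hD : bounded_operator D := diag_bop he he M20 dbnd.
have De m : D (e m) = e m *q d m := diag_basis he he M20 dbnd m.
exists e, D, d; split=> //.
- exact: onb_basis.
- by move=> m; split=> //=; have := absb m; rewrite ler_norml => /andP[]; lra.
exists (fun n => transport e (f n)); split=> [n|]; first exact: transport_unitary.
pose W n x := transport e (f n) (D (transport (f n) e x)).
(* The constant 4 collects 1 for truncating [A], 1 for truncating [Q] and 2 for replacing the
   truncated eigenvalues by [d]. *)
have key n : bnd (4 * M / 2 ^+ n) (fun x => W n x - T x).
  have [hfn fad fr] := fP n.
  have p0 : 0 < M / 2 ^+ n by rewrite divr_gt0 // exprn_gt0.
  have hW : bounded_operator (W n).
    apply: bop_comp; first exact: transport_bop.
    by apply: bop_comp => //; apply: transport_bop.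
  have Wf m : W n (f n m) = f n m *q d m.
    rewrite /W transport_basis // De (linS (bop_lin (transport_bop he hfn))).
    by rewrite transport_basis.
  have qi1 (m : nat) : qn (qi : quat R) <= 1 ^+ 2 by rewrite qn_qi expr1n.
  (* A right linear operator that multiplies the basis vectors by [i]. As these are adapted,
     [B = Q J], so truncating [Q] also approximates [B]. *)
  pose J := diag (f n) (f n) (fun=> qi).
  have hJ : bounded_operator J := diag_bop hfn hfn ler01 qi1.
  have Jf m : J (f n m) = f n m *q qi := diag_basis hfn hfn ler01 qi1 m.
  have Jb x : `|J x| <= `|x| by rewrite -[leRHS]mul1r; apply: (diag_bnd hfn hfn ler01 qi1).
  have BJ x : B x = Q (J x).
    apply: (bop_onb_eq hfn hB (bop_comp hQ hJ)) => m.
    by rewrite Jf (linS (bop_lin hQ)); apply: fad.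
  pose An x := \sum_(i < n) (M / 2 ^+ i.+1) *: rho i.*2 x.
  pose Qn x := (M / 2) *: x + \sum_(i < n) (M / 2 / 2 ^+ i.+1) *: rho i.*2.+1 x.
  have hsum N (c : nat -> R) (k : nat -> nat) :
      bounded_operator (fun x => \sum_(i < N) c i *: rho (k i) x).
    elim: N => [|N IH].
      apply: (@bnd_bop _ _ 0) => [x y q|x]; rewrite !big_ord0.
        by rewrite rscale0l addr0.
      by rewrite normr0 mul0r.
    rewrite (_ : (fun x => _) = fun x => (\sum_(i < N) c i *: rho (k i) x) +
      c N *: rho (k N) x); last by apply/funext => x; rewrite big_ord_recr.
    by apply: bop_add => //; apply: bop_scale; case: (rhoI (k N)).
  have hAn : bounded_operator An by apply: (hsum n (fun i => M / 2 ^+ i.+1) double).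
  have hQn : bounded_operator Qn.
    apply: bop_add; last exact: (hsum n (fun i => M / 2 / 2 ^+ i.+1) (fun i => i.*2.+1)).
    by apply: (@bop_scale _ _ _ idfun); apply: bop_id.
  pose an m := \sum_(i < n) M / 2 ^+ i.+1 * (-1) ^+ s i.*2 m.
  pose bn m := \sum_(i < n) M / 2 / 2 ^+ i.+1 * (-1) ^+ s i.*2.+1 m.
  have Anf m : An (f n m) = f n m *q qr (an m).
    rewrite rscale_r /An /an scaler_suml; apply: eq_bigr => i _.
    by rewrite fr ?scalerA // ltn_double.
  have Qnf m : Qn (f n m) = f n m *q qr (M / 2 + bn m).
    rewrite rscale_r /Qn /bn scalerDl scaler_suml; congr (_ + _).
    by apply: eq_bigr => i _; rewrite fr ?scalerA // ltn_Sdouble.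
  (* The truncation of [T] and the conjugate of [D] are both diagonal in [f n], so their difference
     is bounded through its eigenvalues. *)
  pose E x := (An x + Qn (J x)) - W n x.
  have hE : bounded_operator E.
    by apply: bop_sub => //; apply: bop_add => //; apply: bop_comp.
  have Ef m : E (f n m) = f n m *q qc (an m - a m) (bn m - b m).
    rewrite /E Anf Jf (linS (bop_lin hQn)) Qnf Wf !rscaleA -rscaleDr -rscaleBr.
    by congr (_ *q _); apply: quatP => /=; ring.
  have bE : bnd (2 * (M / 2 ^+ n)) E.
    apply: (diag_eigen_bnd hfn _ _ hE Ef) => [|m]; first by rewrite mulr_ge0 // ltW.
    rewrite qn_qc exprMn.
    have h1 : (an m - a m) ^+ 2 <= (M / 2 ^+ n) ^+ 2.
      by apply: sq_le; rewrite distrC; apply: aP.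
    have h2 : (bn m - b m) ^+ 2 <= (M / 2 ^+ n) ^+ 2.
      apply: sq_le; rewrite distrC; apply: (le_trans (bP m n)).
      by rewrite mulrAC ler_piMr ?(ltW p0) // invf_le1 // ler1n.
    exact: (sq_add _ _ _ h1 h2).
  move=> x; have [hAx hQx] := rhoE n.
  have -> : W n x - T x = - (A x - An x) - (Q (J x) - Qn (J x)) - E x.
    rewrite TE BJ /E !opprB [X in _ = X + _]addrACA -opprD.
    by rewrite [RHS]addrC addrA subrK.
  apply: (le_trans (ler_normB _ _)); apply: le_trans (lerD (ler_normB _ _) (bE x)) _.
  have h1 := hAx x; have h2 := hQx (J x); rewrite normrN.
  have h3 : M / 2 / 2 ^+ n * `|J x| <= M / 2 ^+ n * `|x|.
    apply: (@le_trans _ _ (M / 2 ^+ n * `|J x|)).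
      by rewrite ler_wpM2r // mulrAC ler_piMr ?(ltW p0) // invf_le1 // ler1n.
    by rewrite ler_wpM2l // ltW.
  apply: (le_trans (lerD (lerD h1 (le_trans h2 h3)) (lexx _))).
  by rewrite -!mulrDl ler_wpM2r // -[X in _ <= X]mulrA mulrDl four.
have bnd_geom n : 0 <= opnorm ((transport e (f n) \o D \o
    adjoint (transport e (f n))) \- T) <= geometric (4 * M) 2^-1 n.
  have -> : geometric (4 * M) 2^-1 n = 4 * M / 2 ^+ n.
    by rewrite /geometric /= exprVn.
  rewrite (adjointE (transport_adj he (hf n))).
  apply: (@opnorm_le _ _ (4 * M / 2 ^+ n) (fun x => W n x - T x) (key n)).
  by apply: divr_ge0; [apply: mulr_ge0; [exact: ler0n|exact: ltW]|exact: exprn_ge0].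
apply: (squeeze_cvgr (f := fun=> 0) (h := geometric (4 * M) 2^-1)).
- exact: nearW.
- exact: cvg_cst.
apply: cvg_geometric; rewrite ger0_norm ?invr_ge0 ?ler0n //.
by rewrite invf_lt1 ?ltr0n // ltr1n.
Qed.
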